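(* Let $\kappa$ be a singular (uncountable) cardinal with $2^{<\kappa}=\kappa$, and let $X$ be a nonempty regular Hausdorff space of weight at most $\kappa$ such that every open subset of $X$ is a union of at most $\operatorname{cof}(\kappa)$-many closed sets (i.e. $\kappa\text{-}\boldsymbol{\Sigma}^0_1(X)\subseteq \operatorname{cof}(\kappa)^+\text{-}\boldsymbol{\Sigma}^0_2(X)$). Given $\alpha<\kappa^+$, let $\widehat{\alpha}=\operatorname{cof}(\alpha)$ if $\alpha$ is limit, and $\widehat{\alpha}=\operatorname{cof}(\kappa)$ otherwise. (1) If $\alpha$ is even, then $\kappa\text{-}\boldsymbol{\Sigma}^0_{1+\alpha}(X)=\kappa^+\text{-}\boldsymbol{\Sigma}^0_{1+\frac{\alpha}{2}}(X)$, and, if $\alpha>0$, this class is also equal to the family of all unions of at most $\widehat{\alpha}$-many sets from $\bigcup_{\beta<\alpha}\kappa\text{-}\boldsymbol{\Pi}^0_{1+\beta}(X)$. Dually, $\kappa\text{-}\boldsymbol{\Pi}^0_{1+\alpha}(X)=\kappa^+\text{-}\boldsymbol{\Pi}^0_{1+\frac{\alpha}{2}}(X)$, and, if $\alpha>0$, this class is also equal to the family of all intersections of at most $\widehat{\alpha}$-many sets from $\bigcup_{\beta<\alpha}\kappa\text{-}\boldsymbol{\Sigma}^0_{1+\beta}(X)$. (2) If $\alpha$ is odd, then $\kappa\text{-}\boldsymbol{\Sigma}^0_{1+\alpha}(X)=\kappa\text{-}\boldsymbol{\Pi}^0_{1+\alpha}(X)=\kappa\text{-}\boldsymbol{\Del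ta}^0_{1+\alpha}(X)$.
   Context: For a topological space $X$ and an ordinal $\gamma>\omega$, define by recursion on ordinals $\alpha\ge 1$: $\gamma\text{-}\boldsymbol{\Sigma}^0_1(X)$ is the family of open sets; for $\alpha>1$, $\gamma\text{-}\boldsymbol{\Sigma}^0_\alpha(X)$ is the family of all unions $\bigcup_{\xi<\delta}A_\xi$ with $\delta<\gamma$ and each $A_\xi\in\bigcup_{1\le\beta<\alpha}\gamma\text{-}\boldsymbol{\Pi}^0_\beta(X)$; $\gamma\text{-}\boldsymbol{\Pi}^0_\alpha(X)$ is the family of complements of sets in $\gamma\text{-}\boldsymbol{\Sigma}^0_\alpha(X)$; and $\gamma\text{-}\boldsymbol{\Delta}^0_\alpha(X)=\gamma\text{-}\boldsymbol{\Sigma}^0_\alpha(X)\cap\gamma\text{-}\boldsymbol{\Pi}^0_\alpha(X)$. Every ordinal $\alpha$ is written uniquely as $\alpha=\lambda+n$ with $n<\omega$ and $\lambda=0$ or $\lambda$ limit; $\alpha$ is even (odd) if $n$ is even (odd). If $\alpha=\lambda+n$ is even, set $\frac{\alpha}{2}=\lambda+\frac{n}{2}$. *)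

(* Defs.v *)
From HB Require Import structures.
From mathcomp Require Import all_boot all_order.
From mathcomp Require Import boolp classical_sets functions cardinality wochoice.
From mathcomp Require Import filter topology.

Set Implicit Arguments.
Unset Strict Implicit.
Unset Printing Implicit Defensive.

Local Open Scope classical_set_scope.
Local Open Scope card_scope.

(* Ordinals are represented by well-ordered types and compared up to [oiso].  *)
Record ord := Ord {
  ocarrier :> Type;
  ole : rel ocarrier;
  ole_wo : well_order ole }.

Arguments ole {o} : rename.

Declare Scope ord_scope.
Delimit Scope ord_scope with ord.
Bind Scope ord_scope with ord.
Local Open Scope ord_scope.

Definition olt (w : ord) (x y : w) : bool := ~~ ole y x.

Definition oiso (v w : ord) : Prop :=
  exists f : v -> w, bijective f /\ {mono f : x y / ole x y}.

(* [v] is isomorphic to a proper initial segment of [w]. *)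
Definition ord_lt (v w : ord) : Prop :=
  exists (f : v -> w) (y : w),
    {mono f : x y / ole x y} /\ range f = [set z | olt z y].

Definition ord_le (v w : ord) : Prop := ord_lt v w \/ oiso v w.

Notation "v =o w" := (oiso v w) (at level 70) : ord_scope.
Notation "v <o w" := (ord_lt v w) (at level 70) : ord_scope.
Notation "v <=o w" := (ord_le v w) (at level 70) : ord_scope.

Section WellOrderTheory.
Variable w : ord.
Implicit Types x y z : w.

Lemma ex_omin (P : w -> Prop) : (exists x, P x) ->
  exists2 x, P x & forall y, P y -> ole x y.
Proof.
move=> [x Px]; have [|z [[/asboolP Pz zmin] _]] := @ole_wo w [pred y | `[< P y >]].
  by exists x; apply/asboolP.
by exists z => // y Py; apply: zmin; apply/asboolP.
Qed.

Lemma ole_total x y : ole x y || ole y x.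
Proof.
have [|z [->|->] zmin] := @ex_omin (fun z => z = x \/ z = y).
- by exists x; left.
- by rewrite zmin//; right.
- by rewrite (zmin x) ?orbT//; left.
Qed.

Lemma ole_refl x : ole x x.
Proof. by have := ole_total x x; rewrite orbb. Qed.

Lemma ole_anti x y : ole x y -> ole y x -> x = y.
Proof.
move=> xy yx; have [|z [_ zuniq]] := @ole_wo w [pred z | `[< z = x \/ z = y >]].
  by exists x; apply/asboolP; left.
have <- : z = x.
  by apply: zuniq; split=> [|t /asboolP[]->]//; [apply/asboolP; left|exact: ole_refl].
by apply: zuniq; split=> [|t /asboolP[]->]//; [apply/asboolP; right|exact: ole_refl].
Qed.

Lemma ole_trans y x z : ole x y -> ole y z -> ole x z.
Proof.
move=> xy yz.
have [|t tP tmin] := @ex_omin (fun t => [\/ t = x, t = y | t = z]).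
  by exists x; constructor 1.
have tx : ole t x by apply: tmin; constructor 1.
have ty : ole t y by apply: tmin; constructor 2.
have tz : ole t z by apply: tmin; constructor 3.
case: tP => et; first by rewrite -et.
  by rewrite (ole_anti xy) // -et.
by rewrite (ole_anti yz _) -?et// -?et// in xy *.
Qed.

Lemma olt_irr x : olt x x = false.
Proof. by rewrite /olt ole_refl. Qed.

Lemma oltW x y : olt x y -> ole x y.
Proof. by rewrite /olt => /negbTE yx; have := ole_total x y; rewrite yx orbF. Qed.

Lemma olt_trans y x z : olt x y -> olt y z -> olt x z.
Proof. by move=> xy; apply: contra => zx; apply: ole_trans zx (oltW xy). Qed.

Lemma olt_total x y : [\/ olt x y, x = y | olt y x].
Proof.
have [yx|] := boolP (ole y x); last by constructor 1.
have [xy|] := boolP (ole x y); last by constructor 3.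
by constructor 2; apply: ole_anti.
Qed.

Lemma oind (P : w -> Prop) :
  (forall x, (forall y, olt y x -> P y) -> P x) -> forall x, P x.
Proof.
move=> IH x; apply: contrapT => nPx.
have [|z nPz zmin] := @ex_omin (fun z => ~ P z); first by exists x.
apply: nPz; apply: IH => y yz; apply: contrapT => /zmin zy.
by rewrite /olt zy in yz.
Qed.

End WellOrderTheory.

Lemma mono_olt (v w : ord) (f : v -> w) :
  {homo f : x y / olt x y} -> {mono f : x y / ole x y}.
Proof.
move=> fh x y; apply/idP/idP; last first.
  by case: (olt_total x y) => [/fh/oltW|->|]//; rewrite ?ole_refl// /olt => /negbTE->.
by apply: contraLR => /fh.
Qed.

Lemma mono_inj (v w : ord) (f : v -> w) : {mono f : x y / ole x y} -> injective f.
Proof.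
by move=> fm x y e; apply: ole_anti; rewrite -fm e ole_refl.
Qed.

Lemma oiso_refl w : w =o w.
Proof. by exists id; split=> //; exists id. Qed.

Lemma ord_lt_trans v u w : u <o v -> v <o w -> u <o w.
Proof.
move=> [f [y [fm fr]]] [g [z [gm gr]]]; exists (g \o f), (g y); split.
  by move=> a b /=; rewrite gm fm.
apply/seteqP; split=> [_ [a _ <-]|t] /=.
  have : range f (f a) by exists a.
  by rewrite fr /= /olt gm.
move=> tgy; have : range g t.
  rewrite gr /=; apply: olt_trans tgy _.
  by have : range g (g y) by [exists y]; rewrite gr.
move=> [b _ eb]; have : range f b by rewrite fr /= /olt -gm eb.
by move=> [a _ ea]; exists a => //=; rewrite ea eb.
Qed.

Lemma ord_lt_wf : well_founded ord_lt.
Proof.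
have H (w : ord) (x : w) : forall (v : ord) (f : v -> w), {mono f : a b / ole a b} ->
    range f = [set y | olt y x] -> Acc ord_lt v.
  elim/oind: x => x IH v f fm fr; constructor=> u [g [z [gm gr]]].
  have fzx : olt (f z) x by have : range f (f z) by [exists z]; rewrite fr.
  apply: (IH (f z) fzx u (f \o g)); first by move=> a b /=; rewrite fm gm.
  apply/seteqP; split=> [_ [a _ <-]|t] /=.
    have : range g (g a) by exists a.
    by rewrite gr /= /olt fm.
  move=> tfz; have : range f t by rewrite fr /=; apply: olt_trans fzx.
  move=> [b _ eb]; have : range g b by rewrite gr /= /olt -fm eb.
  by move=> [a _ ea]; exists a => //=; rewrite ea eb.
by move=> w; constructor=> v [f [y [fm fr]]]; exact: (H w y v f).
Qed.

Lemma ord_lt_irr w : ~ w <o w.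
Proof. by elim: (ord_lt_wf w) => {}w _ IH h; exact: (IH w h). Qed.

(* [x] and [y] have isomorphic sets of predecessors. *)
Inductive same_rank (v w : ord) : v -> w -> Prop := SameRank x y of
  (forall x', olt x' x -> exists2 y', olt y' y & same_rank x' y') &
  (forall y', olt y' y -> exists2 x', olt x' x & same_rank x' y') :
  same_rank x y.

Section Comparison.
Variables v w : ord.
Local Notation G := (@same_rank v w).

Lemma same_rankE x y : G x y ->
  (forall x', olt x' x -> exists2 y', olt y' y & G x' y') /\
  (forall y', olt y' y -> exists2 x', olt x' x & G x' y').
Proof. by case. Qed.

Lemma same_rank_fun x y y' : G x y -> G x y' -> y = y'.
Proof.
elim/oind: x y y' => x IH.
suff H y y' : G x y -> G x y' -> ~ olt y y'.
  move=> y y' h h'; have [/(H _ _ h h')|//|/(H _ _ h' h)] // := olt_total y y'.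
move=> /same_rankE[h _] /same_rankE[_ h'] yy'.
have [x' x'x g] := h' _ yy'; have [y2 y2y g2] := h _ x'x.
by move: y2y; rewrite (IH _ x'x _ _ g2 g) olt_irr.
Qed.

Lemma same_rank_inj x x' y : G x y -> G x' y -> x = x'.
Proof.
elim/oind: y x x' => y IH.
suff H x x' : G x y -> G x' y -> ~ olt x x'.
  move=> x x' h h'; have [/(H _ _ h h')|//|/(H _ _ h' h)] // := olt_total x x'.
move=> /same_rankE[_ h] /same_rankE[h' _] xx'.
have [y' y'y g] := h' _ xx'; have [x2 x2x g2] := h _ y'y.
by move: x2x; rewrite (IH _ y'y _ _ g2 g) olt_irr.
Qed.

Lemma same_rank_lt x y x' y' : G x y -> G x' y' -> olt x x' = olt y y'.
Proof.
move=> h h'; have [h1 h2] := same_rankE h'; apply/idP/idP.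
  by move=> /h1[y1 y1y g]; rewrite (same_rank_fun h g).
by move=> /h2[x1 x1x g]; rewrite (same_rank_inj h g).
Qed.

Lemma same_rank_cover :
  (forall x, exists y, G x y) \/ (forall y, exists x, G x y).
Proof.
apply: contrapT => /not_orP[/existsNP nx /existsNP ny].
have [x0 nx0 xmin] := ex_omin nx; have [y0 ny0 ymin] := ex_omin ny.
have xdom x : olt x x0 -> exists y, G x y.
  by move=> xx0; apply: contrapT => /xmin h; rewrite /olt h in xx0.
have ydom y : olt y y0 -> exists x, G x y.
  by move=> yy0; apply: contrapT => /ymin h; rewrite /olt h in yy0.
apply: (nx0); exists y0; constructor=> [x xx0|y yy0].
  have [y g] := xdom _ xx0; exists y => //.
  have [//|e|y0y] := olt_total y y0; first by case: ny0; exists x; rewrite -e.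
  by have [_ /(_ _ y0y)[x1 _ g1]] := same_rankE g; case: ny0; exists x1.
have [x g] := ydom _ yy0; exists x => //.
have [//|e|x0x] := olt_total x x0; first by case: nx0; exists y; rewrite -e.
by have [/(_ _ x0x)[y1 _ g1] _] := same_rankE g; case: nx0; exists y1.
Qed.

Lemma same_rank_le : (forall x, exists y, G x y) -> v <=o w.
Proof.
move=> /choice[f fG].
have fm : {mono f : x y / ole x y}.
  by apply: mono_olt => x y xy; rewrite -(same_rank_lt (fG x) (fG y)).
have [fsurj|/existsNP/ex_omin[y0 ny0 ymin]] := EM (forall y, exists x, f x = y).
  right; exists f; split=> //.
  have [g gK] := choice fsurj; exists g => // x.
  by apply: (mono_inj fm); rewrite gK.
left; exists f, y0; split=> //; apply/seteqP; split=> [_ [x _ <-]|y /= yy0].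
  have [//|e|y0fx] := olt_total (f x) y0; first by case: ny0; exists x.
  have [_ /(_ _ y0fx)[x1 _ g1]] := same_rankE (fG x).
  by case: ny0; exists x1; apply: same_rank_fun (fG x1) g1.
have [x <-] : exists x, f x = y; last by exists x.
by apply: contrapT => /ymin h; rewrite /olt h in yy0.
Qed.
End Comparison.

Lemma same_rank_sym (v w : ord) (x : v) (y : w) : same_rank x y -> same_rank y x.
Proof.
elim/oind: x y => x IH y /same_rankE[h h']; constructor.
  by move=> y' /h'[x' x'x g]; exists x' => //; apply: IH.
by move=> x' x'x; have [y' y'y g] := h _ x'x; exists y' => //; apply: IH.
Qed.

Lemma oiso_sym v w : v =o w -> w =o v.
Proof.
move=> [f [[g fK gK] fm]]; exists g; split; first by exists f.
by move=> x y; rewrite -fm !gK.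
Qed.

Lemma oiso_trans v u w : u =o v -> v =o w -> u =o w.
Proof.
move=> [f [fb fm]] [g [gb gm]]; exists (g \o f); split; first exact: bij_comp.
by move=> x y /=; rewrite gm fm.
Qed.

Lemma oiso_ltl v u w : u =o v -> v <o w -> u <o w.
Proof.
move=> [f [[f' fK f'K] fm]] [g [z [gm gr]]]; exists (g \o f), z; split.
  by move=> x y /=; rewrite gm fm.
rewrite -gr; apply/seteqP; split=> [_ [x _ <-]|_ [x _ <-]]; first by exists (f x).
by exists (f' x) => //=; rewrite f'K.
Qed.

Lemma oiso_ltr v u w : u <o v -> v =o w -> u <o w.
Proof.
move=> [f [y [fm fr]]] [g [[g' gK g'K] gm]]; exists (g \o f), (g y); split.
  by move=> a b /=; rewrite gm fm.
apply/seteqP; split=> [_ [a _ <-]|t] /=.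
  by have : range f (f a) by [exists a]; rewrite fr /= /olt gm.
move=> tgy; have : range f (g' t) by rewrite fr /= /olt -gm g'K.
by move=> [a _ ea]; exists a => //=; rewrite ea g'K.
Qed.

Lemma ord_le_total v w : v <=o w \/ w <=o v.
Proof.
have [/same_rank_le|h] := @same_rank_cover v w; [by left|right].
by apply: same_rank_le => y; have [x /same_rank_sym g] := h y; exists x.
Qed.

Lemma ord_leNgt v w : v <=o w <-> ~ w <o v.
Proof.
split=> [[vw wv|/oiso_ltr vw /vw]|wv].
- exact: ord_lt_irr (ord_lt_trans vw wv).
- exact: ord_lt_irr.
have [//|[//|/oiso_sym]] := ord_le_total v w; by right.
Qed.

Lemma card_leTP (T U : Type) :
  [set: T] #<= [set: U] <-> exists f : T -> U, injective f.
Proof.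
split=> [/card_leP[f]|[f finj]].
  exists (fun x => \val (f (SigSub (mem_set (I : setT x))))) => x y /val_inj.
  by move=> /(@inj _ _ _ f); rewrite !inE => /(_ I I)/(congr1 val).
have /injfunPex[g] : exists2 f : T -> U, set_fun setT setT f & set_inj setT f.
  by exists f => // x y _ _; exact: finj.
exact: inj_card_le.
Qed.

Lemma ord_le_card v w : v <=o w -> [set: v] #<= [set: w].
Proof.
move=> vw; apply/card_leTP.
by case: vw => [[f [y [fm _]]]|[f [_ fm]]]; exists f; exact: mono_inj fm.
Qed.

Lemma ofin_wo (n : nat) : well_order (fun i j : 'I_n => (i <= j)%N).
Proof.
apply: antisymmetric_well_order => [i j /anti_leq/val_inj//|A [i Ai]].
by case: (arg_minnP val Ai) => j Aj jmin; exists j; split=> // k /jmin.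
Qed.

Definition ofin (n : nat) : ord := Ord (@ofin_wo n).

Section Sum.
Variables v w : ord.

Definition ole_sum (x y : v + w) : bool :=
  match x, y with
  | inl a, inl b => ole a b
  | inl _, inr _ => true
  | inr _, inl _ => false
  | inr a, inr b => ole a b
  end.

Lemma ole_sum_wo : well_order ole_sum.
Proof.
apply: antisymmetric_well_order.
  move=> [a|a] [b|b] /andP[]//= ab ba; congr (_ _); exact: ole_anti.
move=> A [z Az]; have [|Av] := EM (exists a, inl a \in A).
  by move=> /ex_omin[a Aa amin]; exists (inl a); split=> // -[b|b]//= /amin.
have /ex_omin[b Ab bmin] : exists b, inr b \in A.
  by case: z Az => [a Aa|b]; [case: Av; exists a|exists b].
by exists (inr b); split=> // -[a|c]//= => [Aa|/bmin//]; case: Av; exists a.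
Qed.

End Sum.

Definition oadd (v w : ord) : ord := Ord (@ole_sum_wo v w).
Notation "v +o w" := (oadd v w) (at level 50, left associativity) : ord_scope.

(* An arbitrary element of [P], and the ordinal 0 if there is none.           *)
Definition opick (P : ord -> Prop) : ord :=
  match pselect (exists w, P w) with
  | left ex => projT1 (cid ex)
  | right _ => ofin 0
  end.

Lemma opickP (P : ord -> Prop) : (exists w, P w) -> P (opick P).
Proof. by move=> ex; rewrite /opick; case: pselect => // ex'; case: cid. Qed.

Definition oleast (P : ord -> Prop) : ord :=
  opick (fun w => P w /\ forall v, P v -> w <=o v).

Lemma oleastP (P : ord -> Prop) : (exists w, P w) ->
  P (oleast P) /\ forall v, P v -> oleast P <=o v.
Proof.
move=> [w Pw]; apply: (opickP (P := fun w => P w /\ _)).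
elim: (ord_lt_wf w) Pw => {}w _ IH Pw.
have [[v [Pv vw]]|h] := EM (exists v, P v /\ v <o w); first exact: IH vw Pv.
by exists w; split=> // v Pv; apply/ord_leNgt => vw; apply: h; exists v.
Qed.

Definition osup (P : ord -> Prop) : ord :=
  oleast (fun w => forall v, P v -> v <=o w).

(* Cardinals are initial ordinals. *)
Definition is_card (w : ord) : Prop :=
  forall v, v <o w -> ~ ([set: v] #= [set: w]).

Definition ocard (T : Type) : ord := oleast (fun w => [set: w] #= [set: T]).

Lemma card_eqT (T : Type) : [set: ocard T] #= [set: T].
Proof.
apply: (proj1 (oleastP (P := fun w : ord => is_true ([set: w] #= [set: T])) _)).
by have [R Rwo] := @well_ordering_principle {classic T}; exists (Ord Rwo).
Qed.

Lemma card_min (T : Type) (v : ord) : [set: v] #= [set: T] -> ocard T <=o v.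
Proof.
apply: (proj2 (oleastP (P := fun w : ord => is_true ([set: w] #= [set: T])) _)).
by exists (ocard T); exact: card_eqT.
Qed.

Lemma is_card_card (T : Type) : is_card (ocard T).
Proof.
move=> v vT vE; have /card_min/ord_leNgt : [set: v] #= [set: T]; last exact.
by apply: card_eq_trans vE (card_eqT T).
Qed.

Lemma is_card_le v w : is_card v -> v <=o w <-> [set: v] #<= [set: w].
Proof.
move=> vc; split=> [/ord_le_card//|vw]; apply/ord_leNgt => wv.
by apply: (vc _ wv); apply: Cantor_Bernstein => //; apply: ord_le_card; left.
Qed.

Lemma cantor_card_lt w : w <o ocard (w -> bool).
Proof.
apply: contrapT => /ord_leNgt/ord_le_card h.
have /card_leTP[f finj] : [set: w -> bool] #<= [set: w].
  by rewrite -(card_le_eql (card_eqT _)).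
pose D x := `[< exists2 A, f A = x & ~~ A x >].
have E : D (f D) = ~~ D (f D).
  apply/asboolP/idP => [[A /finj->//]|nD]; by exists D.
by case: (D (f D)) E.
Qed.

Definition succ_card (k : ord) : ord := oleast (fun w => is_card w /\ k <o w).

Lemma succ_cardP k : [/\ is_card (succ_card k), k <o succ_card k &
  forall w, is_card w -> k <o w -> succ_card k <=o w].
Proof.
have [|[c kc] h] := @oleastP (fun w => is_card w /\ k <o w).
  by exists (ocard (k -> bool)); split; [exact: is_card_card|exact: cantor_card_lt].
by split=> // w wc kw; apply: h.
Qed.

Definition cof (a : ord) : ord :=
  oleast (fun m => exists f : m -> a, forall x, exists i, ole x (f i)).

Lemma cofP a : (exists f : cof a -> a, forall x, exists i, ole x (f i)) /\
  forall m : ord, (exists f : m -> a, forall x, exists i, ole x (f i)) -> cof a <=o m.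
Proof.
apply: (@oleastP (fun m : ord => exists f : m -> a, forall x, exists i, ole x (f i))).
by exists a, id => x; exists x; exact: ole_refl.
Qed.

(* 2^{<k}, the supremum of the cardinals 2^l for l < k a cardinal. *)
Definition weak_pow2 (k : ord) : ord :=
  osup (fun w => exists2 l : ord, is_card l /\ l <o k & w = ocard (l -> bool)).

Lemma weak_pow2P k :
  (forall l : ord, is_card l -> l <o k -> ocard (l -> bool) <=o weak_pow2 k) /\
  forall w, (forall l : ord, is_card l -> l <o k -> ocard (l -> bool) <=o w) ->
    weak_pow2 k <=o w.
Proof.
pose P w := exists2 l : ord, is_card l /\ l <o k & w = ocard (l -> bool).
have [|h h'] := @oleastP (fun w => forall v, P v -> v <=o w); last first.
  split=> [l lc lk|w hw]; first by apply: h; exists l.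
  by apply: h' => _ [l [lc lk] ->]; exact: hw.
exists (ocard (k -> bool)) => _ [l [lc lk] ->].
apply/(is_card_le _ (@is_card_card _)).
rewrite (card_le_eql (card_eqT _)) (card_le_eqr (card_eqT _)).
have [|f finj] := (card_leTP l k).1; first by apply: ord_le_card; left.
apply/card_leTP; exists (fun A y => `[< exists2 x, f x = y & A x >]) => A B AB.
apply/funext => x; have := congr1 (@^~ (f x)) AB => /=.
suff E (C : l -> bool) : `[< exists2 z, f z = f x & C z >] = C x by rewrite !E.
by apply/asboolP/idP => [[z /finj->]|Cx] //; exists x.
Qed.

Definition is_singular (k : ord) : Prop :=
  [/\ is_card k, infinite_set [set: k] & cof k <o k].

Definition is_limit (a : ord) : Prop :=
  (exists x : a, True) /\ forall x : a, exists y : a, olt x y.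

(* The unique decomposition a = l + n with l zero or limit and n finite. *)
Definition odecomp (a l : ord) (n : nat) : Prop :=
  (l =o ofin 0 \/ is_limit l) /\ a =o l +o ofin n.

Definition ord_even (a : ord) : Prop := exists l n, odecomp a l n /\ ~~ odd n.
Definition ord_odd (a : ord) : Prop := exists l n, odecomp a l n /\ odd n.

Definition ord_half (a : ord) : ord :=
  opick (fun b => exists l n, odecomp a l n /\ b = l +o ofin n./2).

(* g-Sigma^0_a(X) for ordinals g and a >= 1 (empty for a = 0); membership of   *)
(* [A i] in g-Pi^0_b is written as [~` A i] being in g-Sigma^0_b. The          *)
(* recursive clauses are [Sigma0_1E] and [Sigma0E].                            *)
Inductive Sigma0 (X : topologicalType) (g : ord) : ord -> set (set X) :=
  | Sigma0_open a U : a =o ofin 1 -> open U -> Sigma0 g a U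
  | Sigma0_bigcup a (d : ord) (A : d -> set X) : ofin 1 <o a -> d <o g ->
      (forall i, exists b, [/\ ofin 1 <=o b, b <o a & Sigma0 g b (~` A i)]) ->
      Sigma0 g a (\bigcup_i A i).

Definition Pi0 (X : topologicalType) (g a : ord) : set (set X) :=
  [set A | Sigma0 g a (~` A)].

Definition Delta0 (X : topologicalType) (g a : ord) : set (set X) :=
  Sigma0 g a `&` Pi0 g a.

Arguments Sigma0 X g a : clear implicits.
Arguments Pi0 X g a : clear implicits.
Arguments Delta0 X g a : clear implicits.

Lemma Sigma0_1E (X : topologicalType) (g a : ord) :
  a =o ofin 1 -> Sigma0 X g a = open.
Proof.
move=> a1; apply/seteqP; split=> [U|U Uo]; last exact: Sigma0_open.
move=> SU; case: SU a1 => // b d A b1 _ _ /(oiso_ltr b1) h.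
by case: (ord_lt_irr h).
Qed.

Lemma Sigma0E (X : topologicalType) (g a : ord) : ofin 1 <o a ->
  Sigma0 X g a = [set U | exists (d : ord) (A : d -> set X), [/\ d <o g,
    (forall i, exists b, [/\ ofin 1 <=o b, b <o a & Pi0 X g b (A i)]) &
    U = \bigcup_i A i]].
Proof.
move=> a1; apply/seteqP; split=> [U SU|U [d [A [dg Ab ->]]]].
  case: SU a1 => [b V b1 _ /oiso_ltr /(_ b1) h|b d A b1 dg Ab _].
    by case: (ord_lt_irr h).
  by exists d, A.
exact: Sigma0_bigcup.
Qed.

Definition unions_le (T : Type) (m : ord) (C : set (set T)) : set (set T) :=
  [set U | exists F : set (set T),
    [/\ F `<=` C, F #<= [set: m] & U = \bigcup_(A in F) A]].

Definition inters_le (T : Type) (m : ord) (C : set (set T)) : set (set T) :=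
  [set U | exists F : set (set T),
    [/\ F `<=` C, F #<= [set: m] & U = \bigcap_(A in F) A]].

Definition weight_le (X : topologicalType) (k : ord) : Prop :=
  exists2 B : set (set X), basis B & B #<= [set: k].

Definition cof_hat (k a : ord) : ord :=
  if pselect (is_limit a) then cof a else cof k.

(* The union of the classes g-Pi^0_{1+b}(X) over b < a. *)
Definition Pi0_below (X : topologicalType) (g a : ord) : set (set X) :=
  [set A | exists2 b, b <o a & Pi0 X g (ofin 1 +o b) A].

Definition Sigma0_below (X : topologicalType) (g a : ord) : set (set X) :=
  [set A | exists2 b, b <o a & Sigma0 X g (ofin 1 +o b) A].

Arguments unions_le {T} m C.
Arguments inters_le {T} m C.
Arguments weight_le X k : clear implicits.
Arguments Pi0_below X g a : clear implicits.
Arguments Sigma0_below X g a : clear implicits.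

(* Main.v *)
Require Import Defs.
From mathcomp Require Import all_boot all_order.
From mathcomp Require Import boolp classical_sets functions cardinality wochoice.
From mathcomp Require Import filter topology.

Set Implicit Arguments.
Unset Strict Implicit.
Unset Printing Implicit Defensive.

Local Open Scope classical_set_scope.
Local Open Scope card_scope.
Local Open Scope ord_scope.

(** Call a level the index [a] of the classes of rank [1 + a]. Two facts drive
    the proof, and both come from [k] being a singular strong limit.

    Distributivity. A union of [m] intersections of [n] sets equals an
    intersection, over the choice functions, of unions of [m] sets. If [m] and
    [n] are less than [k], there are fewer than [k] choice functions
    ([unions_inters_distr]). Each closed set is the intersection of [cof k]
    open sets, and inductively each set of an even multiplicative class is an
    intersection of fewer than [k] sets taken from ambiguous classes of lower
    level. Distributing therefore rewrites a short union of sets of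
    multiplicative level [e], [e] even, as a short intersection of sets of
    additive level [e]: the level [e + 1] is ambiguous ([S_eq_P_odd]).

    Grouping. A cofinal map [cof k -> k] cuts a union of length [k] into
    [cof k] unions of length less than [k] ([unions_le_cof]). At level [e + 2]
    the short unions are sets of the ambiguous level [e + 1], so unions of [k]
    sets of multiplicative level [e] give the same class as unions of fewer
    than [k], or of [cof k], sets of level [e + 1]; each step of the hierarchy
    with unions of length [k] thus costs two steps of the hierarchy with unions
    shorter than [k] ([collapse_succ2]). At a limit level [a] the sets are
    grouped instead by their level along a cofinal map [cof a -> a]
    ([unions_le_limit]), and [cof a < k] because no cofinality equals a
    singular cardinal ([cof_lt_singular]).

    That [k] is a strong limit follows from [2^{<k} = k] and singularity by
    Koenig's theorem ([singular_strong_limit]); the cardinal arithmetic rests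
    on [card_square], that an infinite set is equipotent to its square. *)

(** * Comparison of ordinals *)

Lemma ord_ltNle v w : v <o w <-> ~ w <=o v.
Proof.
split=> [vw /ord_leNgt//|h]; apply: contrapT => vw.
by apply: h; apply/ord_leNgt.
Qed.

Lemma ord_lexx w : w <=o w.
Proof. by right; exact: oiso_refl. Qed.

Lemma ord_le_lt_trans v u w : u <=o v -> v <o w -> u <o w.
Proof. by case=> [uv|uv]; [exact: ord_lt_trans|exact: oiso_ltl]. Qed.

Lemma ord_lt_le_trans v u w : u <o v -> v <=o w -> u <o w.
Proof. by move=> uv [|]; [exact: ord_lt_trans|exact: oiso_ltr]. Qed.

Lemma ord_le_trans v u w : u <=o v -> v <=o w -> u <=o w.
Proof.
by move=> uv vw; apply/ord_leNgt => wu; apply: ((ord_leNgt u v).1 uv);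
  apply: ord_le_lt_trans wu.
Qed.

Lemma ord_le_anti v w : v <=o w -> w <=o v -> v =o w.
Proof. by case=> // vw /ord_leNgt. Qed.

Lemma mono_surj_oiso (v w : ord) (f : v -> w) :
  {mono f : x y / ole x y} -> (forall y, exists x, f x = y) -> v =o w.
Proof.
move=> fm /choice[g gK]; exists f; split=> //; exists g => // x.
by apply: (Defs.mono_inj fm); rewrite gK.
Qed.

Lemma mono_self_ole (w : ord) (f : w -> w) :
  {mono f : x y / ole x y} -> forall x, ole x (f x).
Proof.
move=> fm; elim/oind => x IH; apply: contrapT => /negP fx.
by have := IH _ fx; rewrite fm (negbTE fx).
Qed.

(** An order embedding need not have an initial segment as its range; it still
    bounds the order type, because a self-embedding never decreases a point. *)
Lemma mono_ord_le (v w : ord) (f : v -> w) :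
  {mono f : x y / ole x y} -> v <=o w.
Proof.
move=> fm; apply/ord_leNgt => -[h [y [hm hr]]].
have : ole (f y) (f (h (f y))).
  by apply: (@mono_self_ole w (f \o h)) => a b /=; rewrite fm hm.
have : olt (h (f y)) y by have : range h (h (f y)) by [exists (f y)]; rewrite hr.
by rewrite fm /olt => /negP.
Qed.

Section Pullback.
Variables (T : Type) (w : ord) (f : T -> w).
Hypothesis finj : injective f.

Lemma opull_wo : well_order (fun x y : T => ole (f x) (f y)).
Proof.
apply: antisymmetric_well_order => [x y /andP[xy yx]|A [z Az]].
  by apply: finj; exact: ole_anti.
have /ex_omin[y [x xA <-] ymin] : exists y, exists2 x, x \in A & f x = y.
  by exists (f z), z.
by exists x; split=> // t tA; apply: ymin; exists t.
Qed.

Definition opull : ord := Ord opull_wo.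
End Pullback.

Lemma sval_inj (T : Type) (P : T -> Prop) : injective (@proj1_sig T P).
Proof. by move=> [x px] [y py] /= e; subst y; rewrite (Prop_irrelevance px py). Qed.

Definition oseg (w : ord) (x : w) : ord :=
  opull (@sval_inj w (fun y => olt y x)).

Section Segments.
Variable w : ord.
Implicit Types x y : w.

Lemma oseg_lt x : oseg x <o w.
Proof.
exists (fun y : oseg x => sval y), x; split=> //.
apply/seteqP; split=> [_ [[y yx] _ <-]//|y yx].
by exists (exist _ y yx).
Qed.

Lemma oseg_leP x y : oseg x <=o oseg y <-> ole x y.
Proof.
split=> [|xy].
  move=> /ord_leNgt xy; apply: contrapT => /negP yx; apply: xy.
  exists (fun z : oseg y => exist _ (sval z) (olt_trans (svalP z) yx) : oseg x).
  exists (exist _ y yx : oseg x); split=> //.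
  apply/seteqP; split=> [_ [[z zy] _ <-]//|[z zx] /= zy].
  by exists (exist _ z zy) => //; exact: sval_inj.
have h z : olt z x -> olt z y by apply: contra; exact: ole_trans.
apply: (@mono_ord_le (oseg x) (oseg y) (fun z => exist _ (sval z) (h _ (svalP z)))).
by [].
Qed.

Lemma ord_lt_oseg (v : ord) : v <o w -> exists x, v =o oseg x.
Proof.
move=> [f [y [fm fr]]]; exists y.
have h z : olt (f z) y by have : range f (f z) by [exists z]; rewrite fr.
apply: (@mono_surj_oiso v (oseg y) (fun z => exist _ (f z) (h z))).
  by move=> a b; rewrite /= -fm.
move=> [z zy]; have [x _ xz] : range f z by rewrite fr.
by exists x; exact: sval_inj.
Qed.
End Segments.

(** * Addition, successors and limits *)

Lemma oadd_mono (u u' v v' : ord) (f : u -> u') (g : v -> v') :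
  {mono f : x y / ole x y} -> {mono g : x y / ole x y} ->
  {mono (fun x : u +o v => match x with inl a => inl (f a) | inr b => inr (g b) end
         : u' +o v') : x y / ole x y}.
Proof. by move=> fm gm [a|a] [b|b] /=; rewrite -?fm -?gm. Qed.

Lemma oadd_iso u u' v v' : u =o u' -> v =o v' -> u +o v =o u' +o v'.
Proof.
move=> [f [[f' fK f'K] fm]] [g [[g' gK g'K] gm]].
apply: mono_surj_oiso (oadd_mono fm gm) _ => -[a|b].
  by exists (inl (f' a)); rewrite f'K.
by exists (inr (g' b)); rewrite g'K.
Qed.

Lemma oaddA u v w : (u +o v) +o w =o u +o (v +o w).
Proof.
apply: (@mono_surj_oiso ((u +o v) +o w) (u +o (v +o w)) (fun x => match x with
  | inl (inl a) => inl a | inl (inr b) => inr (inl b) | inr c => inr (inr c) end)).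
  by move=> [[a|a]|a] [[b|b]|b].
by move=> [a|[b|c]]; [exists (inl (inl a))|exists (inl (inr b))|exists (inr c)].
Qed.

Lemma oadd_lt u v w : v <o w -> u +o v <o u +o w.
Proof.
move=> [f [y [fm fr]]].
exists (fun x => match x with inl a => inl a | inr b => inr (f b) end), (inr y).
split; first exact: (@oadd_mono u u v w id).
apply/seteqP; split=> [_ [[a|b] _ <-]//|[a _|b /= yb]]; last first.
- have [x _ <-] : range f b by rewrite fr.
  by exists (inr x).
- by exists (inl a).
by have : range f (f b) by [exists b]; rewrite fr.
Qed.

Lemma oadd_le u v w : v <=o w -> u +o v <=o u +o w.
Proof.
case=> [vw|vw]; [by left; exact: oadd_lt|right].
by apply: oadd_iso vw; exact: oiso_refl.
Qed.

Lemma oadd_ltP u v w : u +o v <o u +o w <-> v <o w.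
Proof.
split=> [h|]; last exact: oadd_lt.
by apply/ord_ltNle => /(oadd_le u)/ord_leNgt.
Qed.

Lemma le_oaddl u v : u <=o u +o v.
Proof. by apply: (@mono_ord_le u (u +o v) inl). Qed.

Lemma ofin0P w : w =o ofin 0 <-> ~ exists x : w, True.
Proof.
split=> [[f _] [x _]|h]; first by case: (f x).
apply: (@mono_surj_oiso w (ofin 0) (fun x => False_rect _ (h (ex_intro _ x I)))).
  by move=> x; case: h; exists x.
by case.
Qed.

Lemma ofin0_le w : ofin 0 <=o w.
Proof.
by apply/ord_leNgt => -[f [y _]]; case: y.
Qed.

Lemma oadd0 w : w +o ofin 0 =o w.
Proof.
apply/oiso_sym; apply: (@mono_surj_oiso w (w +o ofin 0) inl) => // -[a|[]//].
by exists a.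
Qed.

Lemma ofinS n : ofin n.+1 =o ofin n +o ofin 1.
Proof.
apply/oiso_sym; apply: (@mono_surj_oiso (ofin n +o ofin 1) (ofin n.+1)
  (fun x => match x with inl i => widen_ord (leqnSn n) i | inr _ => ord_max end)).
  move=> [i|i] [j|j] //=.
  - by rewrite /= ltnW.
  - by rewrite leqNgt ltn_ord.
  - by rewrite leqnn !ord1.
move=> j; have [jn|nj] := ltnP j n.
  by exists (inl (Ordinal jn)); exact: val_inj.
exists (inr ord0); apply: val_inj => /=; apply/eqP.
by rewrite eqn_leq nj -ltnS ltn_ord.
Qed.

Lemma ord_ltS w : w <o w +o ofin 1.
Proof.
exists inl, (inr ord0); split=> //; apply/seteqP; split=> [_ [a _ <-]//|].
by move=> [a _|b]; [exists a|rewrite /= /olt /= ord1].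
Qed.

Lemma ord_gt0 a b : a <o b -> ofin 0 <o b.
Proof. exact: ord_le_lt_trans (ofin0_le a). Qed.

Lemma osucc_gt0 w : ofin 0 <o w +o ofin 1.
Proof. exact: ord_gt0 (ord_ltS w). Qed.

Lemma ord_succ_le c b : c <o b -> c +o ofin 1 <=o b.
Proof.
move=> [f [y [fm fr]]].
have h a : olt (f a) y by have : range f (f a) by [exists a]; rewrite fr.
apply: (@mono_ord_le (c +o ofin 1) b
  (fun x => match x with inl a => f a | inr _ => y end)).
move=> [a|i] [a'|j] //=; rewrite ?ole_refl ?ord1//.
- by rewrite (oltW (h a)).
- by apply/negbTE; exact: h.
Qed.

Lemma ord_lt_succP b c : b <o c +o ofin 1 <-> b <=o c.
Proof.
split=> [h|h]; last exact: ord_le_lt_trans (ord_ltS c).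
by apply/ord_leNgt => /ord_succ_le/ord_leNgt.
Qed.

Lemma osucc_inj b c : b +o ofin 1 =o c +o ofin 1 -> b =o c.
Proof.
move=> h; apply: ord_le_anti; apply/ord_lt_succP.
  exact: oiso_ltr (ord_ltS b) h.
exact: oiso_ltr (ord_ltS c) (oiso_sym h).
Qed.

(** The difference is the order type of the points of [w] beyond the copy of
    [u]. *)
Lemma oadd_diff u w : u <=o w -> exists v, w =o u +o v.
Proof.
case=> [[f [y [fm fr]]]|uw]; last first.
  by exists (ofin 0); apply: oiso_sym; apply: oiso_trans (oadd0 u) uw.
have h a : olt (f a) y by have : range f (f a) by [exists a]; rewrite fr.
exists (opull (@sval_inj w (ole y))); apply/oiso_sym.
apply: (@mono_surj_oiso (u +o opull (@sval_inj w (ole y))) w (fun x => match x with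
   inl a => f a | inr z => sval z end)).
  move=> [a|[z yz]] [b|[t yt]] //=.
    by apply: oltW; have := h a; apply: contra; exact: ole_trans.
  by apply/negbTE; have := h b; apply: contra; exact: ole_trans.
move=> z; have [yz|zy] := boolP (ole y z); first by exists (inr (exist _ z yz)).
have [a _ <-] : range f z by rewrite fr.
by exists (inl a).
Qed.

(** * Limits, parity and halves *)

Lemma is_limit_iso v w : v =o w -> is_limit v -> is_limit w.
Proof.
move=> [f [[g fK gK] fm]] [[x _] h]; split=> [|y]; first by exists (f x).
by have [z yz] := h (g y); exists (f z); rewrite /olt -(gK y) fm.
Qed.

Lemma is_limit_gt0 a : is_limit a -> ofin 0 <o a.
Proof.
by move=> [[x _] _]; have [//|/oiso_sym/ofin0P[]] := ofin0_le a; exists x.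
Qed.

Lemma limit_succ_lt a b : is_limit a -> b <o a -> b +o ofin 1 <o a.
Proof.
move=> [_ alim] /ord_lt_oseg[x bx]; have [y xy] := alim x.
apply: ord_le_lt_trans (oseg_lt y); apply: ord_succ_le.
by apply: (oiso_ltl bx); apply/ord_ltNle => /oseg_leP; apply/negP.
Qed.

Lemma succ_not_limit b : ~ is_limit (b +o ofin 1).
Proof. by move=> /limit_succ_lt/(_ (ord_ltS b))/ord_lt_irr. Qed.

(** An ordinal with a largest element [x] is the successor of the ordinal of
    the predecessors of [x]. *)
Lemma ord_trichotomy a :
  [\/ a =o ofin 0, exists b, a =o b +o ofin 1 | is_limit a].
Proof.
have [[x0 _]|/ofin0P] := EM (exists x : a, True); last by constructor 1.
have [lim|/existsNP[x xmax]] := EM (forall x : a, exists y, olt x y).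
  by constructor 3; split=> //; exists x0.
constructor 2; exists (oseg x); apply: ord_le_anti; last first.
  by apply: ord_succ_le; exact: oseg_lt.
apply/ord_leNgt => /ord_lt_oseg[y /oiso_sym yx].
have : ole y x by apply: contrapT => /negP xy; apply: xmax; exists y.
move=> /oseg_leP/ord_leNgt; apply.
exact: oiso_ltr (ord_ltS _) (oiso_sym yx).
Qed.

Lemma odecomp_iso a b l n : a =o b -> odecomp a l n -> odecomp b l n.
Proof.
by move=> ab [hl al]; split=> //; apply: oiso_trans al; exact: oiso_sym.
Qed.

Lemma odecompS a l n : odecomp a l n -> odecomp (a +o ofin 1) l n.+1.
Proof.
move=> [hl al]; split=> //; apply: oiso_trans (oadd_iso al (oiso_refl _)) _.
apply: oiso_trans (oaddA _ _ _) _; apply: oadd_iso (oiso_refl _) _.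
exact/oiso_sym/ofinS.
Qed.

Lemma oadd_ofinS l n : l +o ofin n.+1 =o (l +o ofin n) +o ofin 1.
Proof.
apply: oiso_trans (oadd_iso (oiso_refl _) (ofinS n)) _.
exact/oiso_sym/oaddA.
Qed.

Lemma odecompP a : exists l n, odecomp a l n.
Proof.
elim: (ord_lt_wf a) => {}a _ IH.
have [a0|[b ab]|alim] := ord_trichotomy a.
- exists a, 0%N; split; [by left|exact/oiso_sym/oadd0].
- have [|l [n ln]] := IH b; first exact: oiso_ltr (ord_ltS b) (oiso_sym ab).
  exists l, n.+1; apply: odecomp_iso (odecompS ln); exact: oiso_sym.
- exists a, 0%N; split; [by right|exact/oiso_sym/oadd0].
Qed.

Lemma limit0_not_succ l b : l =o ofin 0 \/ is_limit l -> ~ l =o b +o ofin 1.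
Proof.
case=> [l0 lb|llim /is_limit_iso /(_ llim)/succ_not_limit//].
have : b <o ofin 0 by apply: oiso_ltr (ord_ltS b) (oiso_trans (oiso_sym lb) l0).
by move=> /ord_ltNle; apply; exact: ofin0_le.
Qed.

(** The decomposition is read off from the top: a successor has a largest
    element, which zero and limits lack. Parity and halves are independent of
    the choice made in [ord_half] for this reason. *)
Lemma odecomp_uniq a l n l' n' :
  odecomp a l n -> odecomp a l' n' -> l =o l' /\ n = n'.
Proof.
move=> [hl al] [hl' al'].
have : l +o ofin n =o l' +o ofin n' by apply: oiso_trans al'; exact: oiso_sym.
elim: n n' {al al'} => [|n IH] [|n'] e.
- by split=> //; apply: oiso_trans (oiso_trans (oiso_sym (oadd0 l)) e) (oadd0 l').
- case: (limit0_not_succ hl (b := l' +o ofin n')).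
  exact: oiso_trans (oiso_trans (oiso_sym (oadd0 l)) e) (oadd_ofinS _ _).
- case: (limit0_not_succ hl' (b := l +o ofin n)).
  exact: oiso_trans (oiso_trans (oiso_sym (oadd0 l')) (oiso_sym e)) (oadd_ofinS _ _).
have [|ll ->] := IH n'; last by [].
apply: osucc_inj; apply: oiso_trans (oiso_sym (oadd_ofinS _ _)) _.
exact: oiso_trans e (oadd_ofinS _ _).
Qed.

Lemma ord_oddS a : ord_even a -> ord_odd (a +o ofin 1).
Proof. by move=> [l [n [d e]]]; exists l, n.+1; split=> //; exact: odecompS. Qed.

Lemma ord_evenS a : ord_odd a -> ord_even (a +o ofin 1).
Proof.
by move=> [l [n [d e]]]; exists l, n.+1; split; [exact: odecompS|rewrite /= e].
Qed.

Lemma ord_even_or_odd a : ord_even a \/ ord_odd a.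
Proof.
have [l [n d]] := odecompP a.
by have [o|e] := boolP (odd n); [right|left]; exists l, n.
Qed.

Lemma ord_odd_pred a : ord_odd a -> exists2 e, ord_even e & a =o e +o ofin 1.
Proof.
move=> [l [[|n] [[hl al] //= o]]].
exists (l +o ofin n); last exact: oiso_trans al (oadd_ofinS _ _).
by exists l, n; split=> //; split=> //; exact: oiso_refl.
Qed.

Lemma ord_even_cases a : ord_even a -> [\/ a =o ofin 0, is_limit a |
  exists2 e, ord_even e & a =o e +o ofin 1 +o ofin 1].
Proof.
move=> [l [[|[|n]] [[hl al] /= o]]] //.
  have {}al := oiso_trans al (oadd0 l).
  case: hl => hl; [constructor 1; exact: oiso_trans hl|constructor 2].
  exact: is_limit_iso (oiso_sym al) hl.
constructor 3; exists (l +o ofin n).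
  exists l, n; split; last by move: o; rewrite negbK.
  by split=> //; exact: oiso_refl.
apply: oiso_trans al _; apply: oiso_trans (oadd_ofinS _ _) _.
exact: oadd_iso (oadd_ofinS _ _) (oiso_refl _).
Qed.

Lemma ord_halfP a l n : odecomp a l n -> ord_half a =o l +o ofin n./2.
Proof.
move=> d; pose P b := exists l n, odecomp a l n /\ b = l +o ofin n./2.
have [|l' [n' [d' e]]] := @opickP P; first by exists (l +o ofin n./2), l, n.
rewrite /ord_half -/P e; have [ll ->] := odecomp_uniq d' d.
exact: oadd_iso (oiso_refl _).
Qed.

Lemma ord_half0 a : a =o ofin 0 -> ord_half a =o ofin 0.
Proof.
move=> a0; apply: oiso_trans (ord_halfP (l := a) (n := 0) _) _.
  by split; [left|exact/oiso_sym/oadd0].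
exact: oiso_trans (oadd0 a) a0.
Qed.

Lemma ord_half_limit a : is_limit a -> ord_half a =o a.
Proof.
move=> alim; apply: oiso_trans (ord_halfP (l := a) (n := 0) _) _.
  by split; [right|exact/oiso_sym/oadd0].
exact: oadd0.
Qed.

Lemma ord_half_iso a b : a =o b -> ord_half a =o ord_half b.
Proof.
move=> ab; have [l [n d]] := odecompP a.
apply: oiso_trans (ord_halfP d) (oiso_sym (ord_halfP _)).
exact: odecomp_iso d.
Qed.

Lemma ord_halfSS a : ord_half (a +o ofin 1 +o ofin 1) =o ord_half a +o ofin 1.
Proof.
have [l [n d]] := odecompP a.
apply: oiso_trans (ord_halfP (odecompS (odecompS d))) _.
apply: oiso_trans (oadd_ofinS _ _) _.
exact: oadd_iso (oiso_sym (ord_halfP d)) (oiso_refl _).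
Qed.

Lemma ofin_le m n : (m <= n)%N -> ofin m <=o ofin n.
Proof. by move=> mn; apply: (@mono_ord_le (ofin m) (ofin n) (widen_ord mn)). Qed.

Lemma ord_half_le a : ord_half a <=o a.
Proof.
have [l [n [hl al]]] := odecompP a.
apply: (@ord_le_trans (l +o ofin n)); last by right; exact: oiso_sym.
apply: (@ord_le_trans (l +o ofin n./2)); first by right; exact: ord_halfP.
by apply/oadd_le/ofin_le; rewrite -{2}(odd_double_half n) -addnn addnCA leq_addr.
Qed.

(** For [c = l + n] take [l + 2n], which stays below every limit above [c]. *)
Lemma limit_half_surj a c : is_limit a -> c <o a ->
  exists b, [/\ ord_even b, b <o a & ord_half b =o c].
Proof.
move=> alim ca; have [l [n [hl cl]]] := odecompP c.
have d : odecomp (l +o ofin n.*2) l n.*2 by split=> //; exact: oiso_refl.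
exists (l +o ofin n.*2); split.
- by exists l, n.*2; rewrite odd_double.
- have la : l <o a.
    by apply: ord_le_lt_trans ca; apply: ord_le_trans (le_oaddl l (ofin n)) _;
      right; exact: oiso_sym.
  elim: n.*2 => [|m IH]; first exact: oiso_ltl (oadd0 l) la.
  by apply: oiso_ltl (oadd_ofinS _ _) _; exact: limit_succ_lt.
- by apply: oiso_trans (ord_halfP d) _; rewrite doubleK; exact: oiso_sym.
Qed.

(** * Cardinal arithmetic *)

Local Notation "T <=c U" := ([set: T] #<= [set: U]) (at level 70).

Lemma inj_card_leT (T U : Type) (f : T -> U) : injective f -> T <=c U.
Proof. by move=> fi; apply/card_leTP; exists f. Qed.

Lemma card_le_ocard T : T <=c ocard T.
Proof. by rewrite (card_le_eqr (card_eqT T)) card_lexx. Qed.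

Lemma ocard_card_le T : ocard T <=c T.
Proof. by rewrite (card_le_eql (card_eqT T)) card_lexx. Qed.

(** Indexing by the cardinal of [T]: a surjection loses nothing in a union, and
    it exists even when [T] is empty. *)
Lemma ocard_surj T : exists h : ocard T -> T, forall t, exists i, h i = t.
Proof.
have [f fi] := (card_leTP _ _).1 (card_le_ocard T).
have [g _] := (card_leTP _ _).1 (ocard_card_le T).
exists (fun i => match pselect (exists t, f t = i) with
  | left e => projT1 (cid e) | right _ => g i end) => t.
exists (f t); case: pselect => [e|[]]; last by exists t.
by case: cid => u /= /fi.
Qed.

Lemma card_le_total T U : T <=c U \/ U <=c T.
Proof.
have [/ord_le_card h|/ord_le_card h] := ord_le_total (ocard T) (ocard U).
  left; apply: card_le_trans (card_le_ocard T) _.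
  exact: card_le_trans h (ocard_card_le U).
right; apply: card_le_trans (card_le_ocard U) _.
exact: card_le_trans h (ocard_card_le T).
Qed.

Lemma card_ltP k v : is_card k -> v <o k <-> ~ (k <=c v).
Proof.
move=> kc; split=> [vk kv|kv]; last by apply/ord_ltNle => /ord_le_card.
by apply: (kc v vk); apply: Cantor_Bernstein => //; apply: ord_le_card; left.
Qed.

Lemma ocard_ltP k T : is_card k -> ocard T <o k <-> ~ (k <=c T).
Proof.
move=> kc; rewrite card_ltP//; split=> h kT; apply: h; apply: card_le_trans kT _.
  exact: card_le_ocard.
exact: ocard_card_le.
Qed.

Lemma finite_option T : finite_set [set: T] -> finite_set [set: option T].
Proof.
move=> Tf; rewrite (_ : [set: option T] = None |` (Some @` [set: T])).
  by rewrite finite_setU; split; [exact: finite_set1|exact: finite_image].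
by apply/seteqP; split=> // -[x _|_]; [right; exists x|left].
Qed.

(** Hilbert's hotel: shift an embedded copy of the integers. *)
Lemma card_option_le T : infinite_set [set: T] -> option T <=c T.
Proof.
move=> /infiniteP/card_leTP[h hinj].
pose s x := match pselect (exists n, h n = x) with
  left e => h (projT1 (cid e)).+1 | right _ => x end.
have sh n : s (h n) = h n.+1.
  rewrite /s; case: pselect => [e|]; last by case; exists n.
  by case: cid => m /= /hinj ->.
have sN x : ~ (exists n, h n = x) -> s x = x by rewrite /s; case: pselect.
pose g o := if o is Some x then s x else h 0.
apply: (@inj_card_leT _ _ g).
have s0 x : s x <> h 0.
  have [[n <-]|nx] := EM (exists n, h n = x); first by rewrite sh => /hinj.
  by rewrite sN// => e; apply: nx; exists 0%N.
have sI x y : s x = s y -> x = y.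
  have [[n <-]|nx] := EM (exists n, h n = x);
    have [[m <-]|ny] := EM (exists n, h n = y).
  - by rewrite !sh => /hinj[->].
  - by rewrite sh sN// => e; case: ny; exists n.+1.
  - by rewrite sh sN// => e; case: nx; exists m.+1.
  - by rewrite !sN.
by move=> [x|] [y|] //= => [/sI->|/s0|/esym/s0].
Qed.

Definition oiseg (w : ord) (y : w) := {x : w | ole x y}.

(** An infinite initial ordinal has no largest element, since adding a point to
    an infinite set does not change its size. *)
Lemma card_oiseg (w : ord) (y : w) :
  is_card w -> infinite_set [set: w] -> ~ (w <=c oiseg y).
Proof.
move=> wc winf h.
have yo : oiseg y <=c option (oseg y).
  pose f (x : oiseg y) : option (oseg y) :=
    match pselect (olt (sval x) y) with
    | left h => Some (exist _ (sval x) h) | right _ => None end.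
  apply: (@inj_card_leT _ _ f) => -[x xy] [z zy]; rewrite /f /=.
  case: pselect => [xy'|xy']; case: pselect => [zy'|zy'] //.
    by move=> [xz]; apply: sval_inj.
  move=> _; apply: sval_inj => /=.
  have eqy t : ole t y -> ~ olt t y -> t = y.
    by move=> ty ty'; apply: ole_anti => //; apply: contrapT => /negP.
  by rewrite (eqy x)// (eqy z).
have [/finite_option sf|sinf] := EM (finite_set [set: oseg y]).
  exact/winf/(card_le_finite (card_le_trans h yo)).
have /(card_ltP _ wc) := oseg_lt y; apply.
exact: card_le_trans h (card_le_trans yo (card_option_le sinf)).
Qed.

Section Lex.
Variables v w : ord.

Definition ole_lex (x y : v * w) : bool :=
  olt x.1 y.1 || (ole x.1 y.1 && ole x.2 y.2).

Lemma ole_lex_wo : well_order ole_lex.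
Proof.
apply: antisymmetric_well_order.
  move=> [a b] [c d]; rewrite /ole_lex /olt /= => /andP[/orP[ca|/andP[ac bd]]].
    by rewrite (negbTE ca) orbF => /negP []; apply: oltW.
  rewrite ac /= => /andP[ca db]; congr (_, _); exact: ole_anti.
move=> A [z Az].
have /ex_omin[a [b Aab] amin] : exists a, exists b, (a, b) \in A.
  by exists z.1, z.2; case: z Az.
have /ex_omin[c Aac cmin] : exists c, (a, c) \in A by exists b.
exists (a, c); split=> // -[d e] Ade; rewrite /ole_lex /=.
have ad : ole a d by apply: amin; exists e.
have [//|e'|] := olt_total a d; last by rewrite /olt ad.
  by move=> ->.
by subst d; rewrite ole_refl cmin ?orbT.
Qed.

Definition olex : ord := Ord ole_lex_wo.
End Lex.

Definition omax (w : ord) (x y : w) : w := if ole x y then y else x.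

Lemma ole_omaxl (w : ord) (x y : w) : ole x (omax x y).
Proof. by rewrite /omax; case: ifP => // _; exact: ole_refl. Qed.

Lemma ole_omaxr (w : ord) (x y : w) : ole y (omax x y).
Proof.
rewrite /omax; case: ifP => [_|]; first exact: ole_refl.
by have /orP[->|] := ole_total x y.
Qed.

Lemma goedel_inj (w : ord) :
  injective (fun z : w * w => ((omax z.1 z.2, z) : olex w (olex w w))).
Proof. by move=> x y [_ ->]. Qed.

(** Goedel's well-order of the square: by maximum, then lexicographically. *)
Definition ogoedel (w : ord) : ord := opull (@goedel_inj w).

Lemma prod_map_inj T U T' U' (f : T -> T') (g : U -> U') :
  injective f -> injective g -> injective (fun x => (f x.1, g x.2)).
Proof. by move=> fi gi [x y] [x' y'] /= [/fi-> /gi->]. Qed.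

Lemma finite_prod T : finite_set [set: T] -> finite_set [set: T * T].
Proof. by move=> Tf; rewrite -setXTT; exact: finite_setX. Qed.

(** A proper initial segment of Goedel's order lies in the square of some
    [oiseg y], which is small by induction; so the order type of the square of
    an initial ordinal cannot exceed that ordinal. *)
Lemma card_square_ord w : is_card w -> infinite_set [set: w] -> (w * w)%type <=c w.
Proof.
elim: (ord_lt_wf w) => {}w _ IH wc winf.
have [//|/(ord_le_card (v := ogoedel w))//] := ord_le_total w (ogoedel w).
case=> [[f [[a b] [fm fr]]]|/oiso_sym gw]; last first.
  by apply: (ord_le_card (v := ogoedel w)); right.
pose c := omax a b; exfalso.
have fc x : ole (omax (f x).1 (f x).2) c.
  have : range f (f x) by exists x.
  rewrite fr /= /olt /= /ole_lex /olt /=; apply: contraNT => h.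
  by rewrite h.
pose g x : oiseg c * oiseg c :=
  (exist _ (f x).1 (ole_trans (ole_omaxl _ _) (fc x)),
   exist _ (f x).2 (ole_trans (ole_omaxr _ _) (fc x))).
have wg : w <=c (oiseg c * oiseg c)%type.
  apply: (@inj_card_leT _ _ g) => x y [e1 e2]; apply: (Defs.mono_inj fm).
  by rewrite (surjective_pairing (f x)) e1 e2 -surjective_pairing.
have cs := card_oiseg (y := c) wc winf.
have cinf : infinite_set [set: oiseg c].
  move=> cf; apply: winf; apply: card_le_finite wg _.
  exact: finite_prod.
apply: cs; apply: card_le_trans wg _.
pose m := ocard (oiseg c).
have mlt : m <o w by apply/ocard_ltP => //; exact: card_oiseg.
have mm : (m * m)%type <=c m.
  apply: IH => //; first exact: is_card_card.
  by apply: contra_not cinf; exact: card_le_finite (card_le_ocard _).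
apply: card_le_trans (card_le_trans mm (ocard_card_le _)).
have [h hi] := (card_leTP _ _).1 (card_le_ocard (oiseg c)).
exact: inj_card_leT (prod_map_inj hi hi).
Qed.

Lemma card_square T : infinite_set [set: T] -> (T * T)%type <=c T.
Proof.
move=> Tinf; have [h hi] := (card_leTP _ _).1 (card_le_ocard T).
apply: card_le_trans (inj_card_leT (prod_map_inj hi hi)) _.
apply: card_le_trans (card_square_ord _ _) (ocard_card_le _).
  exact: is_card_card.
by apply: contra_not Tinf; exact: card_le_finite (card_le_ocard _).
Qed.

Lemma card_prod_le k T U : infinite_set [set: k] ->
  T <=c k -> U <=c k -> (T * U)%type <=c k.
Proof.
move=> kinf /card_leTP[f fi] /card_leTP[g gi].
exact: card_le_trans (inj_card_leT (prod_map_inj fi gi)) (card_square kinf).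
Qed.

Lemma card_sigma_le k I (J : I -> Type) : infinite_set [set: k] ->
  I <=c k -> (forall i, J i <=c k) -> {i & J i} <=c k.
Proof.
move=> kinf Ik Jk.
pose f i := projT1 (cid ((card_leTP _ _).1 (Jk i))).
have fi i : injective (f i) by rewrite /f; case: cid.
apply: card_le_trans (card_prod_le kinf Ik (card_lexx _)).
apply: (@inj_card_leT _ _ (fun x => (projT1 x, f (projT1 x) (projT2 x)))).
by move=> [i x] [j y] /= [ij]; subst j => /fi ->.
Qed.

Lemma card_prod_lt k T U : infinite_set [set: k] ->
  ~ (k <=c T) -> ~ (k <=c U) -> ~ (k <=c (T * U)%type).
Proof.
move=> kinf kT kU h.
have [L [kL TL UL]] : exists L : Type, [/\ ~ (k <=c L), T <=c L & U <=c L].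
  have [TU|UT] := card_le_total T U.
    by exists U; split=> //; exact: card_lexx.
  by exists T; split=> //; exact: card_lexx.
have hL : k <=c (L * L)%type.
  apply: card_le_trans h _; move: TL UL => /card_leTP[f fi] /card_leTP[g gi].
  exact: inj_card_leT (prod_map_inj fi gi).
have [Lf|Linf] := EM (finite_set [set: L]).
  by apply/kinf/(card_le_finite hL); exact: finite_prod.
by apply: kL; exact: card_le_trans hL (card_square Linf).
Qed.

(** A function is determined by its graph. *)
Lemma card_fun_le_pow T U : (T -> U) <=c (T * U -> bool).
Proof.
apply: (@inj_card_leT _ _ (fun f p => `[< f p.1 = p.2 >])) => f g fg.
apply/funext => x; have /= := congr1 (@^~ (x, f x)) fg.
by move=> /esym e; apply/esym/asboolP; rewrite e; apply/asboolP.
Qed.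

Lemma card_pow_mono T U : T <=c U -> (T -> bool) <=c (U -> bool).
Proof.
move=> /card_leTP[f fi].
pose img (A : T -> bool) y := `[< exists2 x, f x = y & A x >].
apply: (@inj_card_leT _ _ img) => A B AB.
apply/funext => x; have := congr1 (@^~ (f x)) AB; rewrite /img /=.
suff E (C : T -> bool) : `[< exists2 z, f z = f x & C z >] = C x by rewrite !E.
by apply/asboolP/idP => [[z /fi->]|Cx] //; exists x.
Qed.

(** * Singular strong limit cardinals *)

Section Singular.
Variable k : ord.
Hypothesis ksing : is_singular k.

Let kc : is_card k. Proof. by case: ksing. Qed.
Let kinf : infinite_set [set: k]. Proof. by case: ksing. Qed.

Lemma cof_singular_lt : ~ (k <=c cof k).
Proof. by apply/(card_ltP _ kc); case: ksing. Qed.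

(** If [2^|T| = k] with [|T| < k], then [k^(cof k) = 2^(|T| * cof k) <= k],
    against Koenig's diagonal argument along a cofinal map. *)
Lemma singular_strong_limit : weak_pow2 k =o k ->
  forall T, ~ (k <=c T) -> ~ (k <=c (T -> bool)).
Proof.
move=> kpow.
have pow_le T : ~ (k <=c T) -> (T -> bool) <=c k.
  move=> kT; apply: card_le_trans (card_pow_mono (card_le_ocard T)) _.
  apply: card_le_trans (card_le_ocard _) _; apply: ord_le_card.
  apply: ord_le_trans (proj1 (weak_pow2P k) _ _ _) _; last by right.
    exact: is_card_card.
  exact/ocard_ltP.
move=> T kT kpT.
have [[f fcof] _] := cofP k.
have /card_leTP[phi phi_inj] : (cof k -> k) <=c k.
  have [g gi] := (card_leTP _ _).1 kpT.
  apply: card_le_trans (pow_le _ (card_prod_lt kinf cof_singular_lt kT)).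
  apply: (@inj_card_leT _ _ (fun h p => g (h p.1) p.2)) => h h' e.
  apply/funext => i; apply: gi; apply/funext => t.
  exact: (congr1 (@^~ (i, t)) e).
(* Fewer than [k] functions [h] have code [phi h] at most [f i], so [d i] can
   avoid their values at [i]. *)
have /choice[d dP] (i : cof k) :
    exists y : k, forall h, ole (phi h) (f i) -> h i <> y.
  apply: contrapT => /forallNP nd; apply: (card_oiseg (y := f i) kc kinf).
  have /choice[h hP] (y : k) : exists h, ole (phi h) (f i) /\ h i = y.
    by have /existsNP[h /not_implyP[h1 /contrapT h2]] := nd y; exists h.
  apply: (@inj_card_leT _ _ (fun y => exist _ (phi (h y)) (proj1 (hP y)))).
  by move=> y z [/phi_inj e]; rewrite -(proj2 (hP y)) -(proj2 (hP z)) e.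
have [i /dP] := fcof (phi d); exact.
Qed.

Lemma card_fun_lt : weak_pow2 k =o k ->
  forall T U, ~ (k <=c T) -> ~ (k <=c U) -> ~ (k <=c (T -> U)).
Proof.
move=> kpow T U kT kU h.
apply: (singular_strong_limit kpow (card_prod_lt kinf kT kU)).
exact: card_le_trans h (card_fun_le_pow _ _).
Qed.

Lemma ord_lt_succ_card v : v <o succ_card k <-> v <=c k.
Proof.
have [sc ks smin] := succ_cardP k; split=> [vs|vk].
  apply: card_le_trans (card_le_ocard v) _; apply: ord_le_card.
  apply/ord_leNgt => /(smin _ (@is_card_card v)) sv.
  have : ocard v <=o v by apply: card_min; exact: card_eqxx.
  by move=> /(ord_le_trans sv)/ord_leNgt.
apply/(card_ltP _ sc) => sv; apply: (proj1 (card_ltP k sc) ks).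
exact: card_le_trans sv vk.
Qed.

(** The range of a cofinal map [cof k -> k] cuts an ordinal of size at most [k]
    into [cof k] pieces of size less than [k]. If the cofinality were at least
    [k], every piece would be bounded, and the bounds would be cofinal. *)
Lemma cof_lt_singular a : a <o succ_card k -> cof a <o k.
Proof.
move=> /ord_lt_succ_card/card_leTP[e ei]; apply/ord_ltNle => ka.
have [[f fcof] _] := cofP k.
suff : cof a <=o cof k.
  by move=> /(ord_le_trans ka)/ord_leNgt; apply; case: ksing.
apply: (proj2 (cofP a)).
have /choice[d dP] (i : cof k) : exists y : a, forall x, ole (e x) (f i) -> ole x y.
  pose E := {x : a | ole (e x) (f i)}.
  have Ek : ocard E <o k.
    apply/(ocard_ltP _ kc) => kE; apply: (card_oiseg (y := f i) kc kinf).
    apply: card_le_trans kE _.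
    apply: (@inj_card_leT E (oiseg (f i)) (fun x => exist _ (e (sval x)) (svalP x))).
    by move=> x y [/ei]; exact: sval_inj.
  apply: contrapT => /forallNP nb; move/ord_ltNle: Ek; apply.
  apply: ord_le_trans ka _; apply: (proj2 (cofP a)).
  have [h hsurj] := ocard_surj E; exists (fun j => sval (h j)) => y.
  have /existsNP[x /not_implyP[xE /negP yx]] := nb y.
  have [j jx] := hsurj (exist _ x xE); exists j; rewrite jx.
  exact: oltW.
by exists d => x; have [i /dP] := fcof (e x); exists i.
Qed.

End Singular.

(** * Unions and intersections of bounded length *)

Lemma unions_leP T (m : ord) (C : set (set T)) U : unions_le m C U <->
  exists (I : Type) (A : I -> set T),
    [/\ I <=c m, forall i, C (A i) & U = \bigcup_i A i].
Proof.
split=> [[F [FC Fm ->]]|[I [A [Im AC ->]]]].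
  exists (set_type F), (fun A => sval A); split=> [|A|].
  - by rewrite (card_le_eql (card_setT F)).
  - by apply: FC; apply: set_mem; exact: (svalP A).
  - apply/seteqP; split=> [x [A FA Ax]|x [[A FA] _ Ax]].
      by exists (exist _ A (mem_set FA)).
    by exists A => //; exact: set_mem.
exists (range A); split=> [_ [i _ <-]//||].
  exact: card_le_trans (card_image_le _ _) Im.
apply/seteqP; split=> [x [i _ Ax]|x [_ [i _ <-] Ax]]; last by exists i.
by exists (A i) => //; exists i.
Qed.

Lemma inters_leC T m (C : set (set T)) U :
  inters_le m C U <-> unions_le m [set A | C (~` A)] (~` U).
Proof.
split=> [[F [FC Fm ->]]|[F [FC Fm UF]]].
  exists (setC @` F); split=> [_ [A FA <-]||].
  - by rewrite /= setCK; exact: FC.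
  - exact: card_le_trans (card_image_le _ _) Fm.
  - by rewrite setC_bigcap bigcup_image.
exists (setC @` F); split=> [_ [A FA <-]||].
- exact: FC.
- exact: card_le_trans (card_image_le _ _) Fm.
- by rewrite bigcap_image -setC_bigcup -UF setCK.
Qed.

Lemma inters_leP T (m : ord) (C : set (set T)) U : inters_le m C U <->
  exists (I : Type) (A : I -> set T),
    [/\ I <=c m, forall i, C (A i) & U = \bigcap_i A i].
Proof.
rewrite inters_leC unions_leP; split=> -[I [A [Im AC UA]]];
    exists I, (fun i => ~` A i); split=> //.
- by rewrite -setC_bigcup -UA setCK.
- by move=> i /=; rewrite setCK.
- by rewrite UA setC_bigcap.
Qed.

Lemma unions_le_sub T m (C D : set (set T)) :
  C `<=` D -> unions_le m C `<=` unions_le m D.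
Proof. by move=> CD U [F [FC Fm UF]]; exists F; split=> // A /FC/CD. Qed.

Lemma unions_le_card T (m n : ord) (C : set (set T)) :
  m <=c n -> unions_le m C `<=` unions_le n C.
Proof.
by move=> mn U [F [FC Fm UF]]; exists F; split=> //; exact: card_le_trans mn.
Qed.

Lemma unions_le1 T m (C : set (set T)) : ofin 1 <=o m -> C `<=` unions_le m C.
Proof.
move=> m1 U CU; apply/unions_leP; exists 'I_1, (fun=> U); split=> //.
  exact: ord_le_card m1.
by apply/seteqP; split=> [x Ux|x []//]; exists ord0.
Qed.

Lemma unions_le_unions T (k : ord) (C : set (set T)) : infinite_set [set: k] ->
  unions_le k (unions_le k C) `<=` unions_le k C.
Proof.
move=> kinf U /unions_leP[I [A [Ik AC ->]]].
have AP i := cid ((unions_leP _ _ _).1 (AC i)).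
pose J i := projT1 (AP i).
have BP i := cid (projT2 (AP i)).
pose B i : J i -> set T := projT1 (BP i).
have BE i : [/\ J i <=c k, forall j, C (B i j) & A i = \bigcup_j B i j].
  exact: projT2 (BP i).
apply/unions_leP; exists {i & J i}, (fun x => B (projT1 x) (projT2 x)); split.
- by apply: card_sigma_le => // i; case: (BE i).
- by move=> x; case: (BE (projT1 x)).
- apply/seteqP; split=> [x [i _]|x [[i j] _ /= Bx]].
    by have [_ _ ->] := BE i => -[j _ Bx]; exists (existT _ i j).
  by exists i => //; have [_ _ ->] := BE i; exists j.
Qed.

(** * Unions over a singular cardinal *)

Section SingularUnions.
Variables (T : Type) (k : ord).
Hypothesis ksing : is_singular k.
Implicit Types C D : set (set T).

Let kc : is_card k. Proof. by case: ksing. Qed.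
Let kinf : infinite_set [set: k]. Proof. by case: ksing. Qed.

Definition unions_lt C : set (set T) :=
  [set U | exists2 m, m <o k & unions_le m C U].

Lemma unions_ltP C U : unions_lt C U <->
  exists (I : Type) (A : I -> set T),
    [/\ ~ (k <=c I), forall i, C (A i) & U = \bigcup_i A i].
Proof.
split=> [[m mk /unions_leP[I [A [Im AC UA]]]]|[I [A [Ik AC UA]]]].
  exists I, A; split=> // kI; apply: (proj1 (card_ltP m kc) mk).
  exact: card_le_trans kI Im.
exists (ocard I); first exact/ocard_ltP.
by apply/unions_leP; exists I, A; split=> //; exact: card_le_ocard.
Qed.

Lemma unions_lt_le C : unions_lt C `<=` unions_le k C.
Proof.
by move=> U [m mk]; apply: unions_le_card; apply: ord_le_card; left.
Qed.

(** Initial segments of [k] are shorter than [k], so a cofinal map [cof k -> k]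
    groups the terms into short unions. *)
Lemma unions_le_cof C : unions_le k C `<=` unions_le (cof k) (unions_lt C).
Proof.
move=> U /unions_leP[I [A [/card_leTP[e ei] AC ->]]].
have [[f fcof] _] := cofP k; pose J j := {i | ole (e i) (f j)}.
apply/unions_leP; exists (cof k), (fun j => \bigcup_(i : J j) A (sval i)); split.
- exact: card_lexx.
- move=> j; apply/unions_ltP; exists (J j), (fun i => A (sval i)); split=> // kJ.
  apply: (card_oiseg (y := f j) kc kinf); apply: card_le_trans kJ _.
  apply: (@inj_card_leT (J j) (oiseg (f j))
    (fun i => exist _ (e (sval i)) (svalP i))).
  by move=> x y [/ei]; exact: sval_inj.
- apply/seteqP; split=> [x [i _ Ax]|x [j _ [i _ Ax]]]; last by exists (sval i).
  have [j ij] := fcof (e i).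
  by exists j => //; exists (exist _ i ij).
Qed.

(** Distributivity of unions over intersections: the intersection runs over
    choice functions, of which there are fewer than [k] by the strong limit
    property. *)
Lemma unions_inters_distr D n m : weak_pow2 k =o k -> n <o k -> m <o k ->
  unions_le m (inters_le n D) `<=`
  [set U | exists2 p, p <o k & inters_le p (unions_le m D) U].
Proof.
move=> kpow nk mk U /unions_leP[I [A [Im AC ->]]].
have AP i := cid ((inters_leP _ _ _).1 (AC i)).
pose J i := projT1 (AP i).
have BP i := cid (projT2 (AP i)).
pose B i : J i -> set T := projT1 (BP i).
have BE i : [/\ J i <=c n, forall j, D (B i j) & A i = \bigcap_j B i j].
  exact: projT2 (BP i).
have Jn i : J i <=c n by case: (BE i).
pose g i := projT1 (cid ((card_leTP _ _).1 (Jn i))).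
have gi i : injective (g i) by rewrite /g; case: cid.
exists (ocard (forall i, J i)).
  apply/(ocard_ltP _ kc) => kJ; apply: (card_fun_lt ksing kpow (T := I) (U := n)).
  - move=> kI; apply: (proj1 (card_ltP m kc) mk); exact: card_le_trans kI Im.
  - exact/(card_ltP n kc).
  apply: card_le_trans kJ _.
  apply: (@inj_card_leT _ _ (fun h i => g i (h i))) => h h' hh'.
  apply: functional_extensionality_dep => i; apply: gi.
  exact: (congr1 (@^~ i) hh').
apply/inters_leP; exists (forall i, J i), (fun h => \bigcup_i B i (h i)); split.
- exact: card_le_ocard.
- move=> h; apply/unions_leP; exists I, (fun i => B i (h i)); split=> // i.
  by case: (BE i).
apply/seteqP; split=> [x [i _]|x xB].
  by have [_ _ ->] := BE i => xB h _; exists i => //; exact: xB.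
apply: contrapT => nxA.
have nB i : exists j, ~ B i j x.
  apply: contrapT => /forallNP h; apply: nxA; exists i => //.
  by have [_ _ ->] := BE i => j _; apply: contrapT => /h.
have [i _] := xB (fun i => projT1 (cid (nB i))) Logic.I.
exact: projT2 (cid (nB i)).
Qed.

End SingularUnions.

(** * The Borel hierarchies *)

Section Hierarchy.
Variables (X : topologicalType) (g : ord).

Lemma Sigma0_iso a b : a =o b -> Sigma0 X g a `<=` Sigma0 X g b.
Proof.
move=> ab U SU; case: SU ab => [c V c1 Vo cb|c d A c1 dg Ab cb].
  by apply: Sigma0_open => //; exact: oiso_trans (oiso_sym cb) c1.
apply: Sigma0_bigcup => //; first exact: oiso_ltr cb.
move=> i; have [e [e1 ec Se]] := Ab i; exists e; split=> //; exact: oiso_ltr cb.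
Qed.

Lemma Sigma0_eq_iso a b : a =o b -> Sigma0 X g a = Sigma0 X g b.
Proof.
by move=> ab; apply/seteqP; split; apply: Sigma0_iso => //; exact: oiso_sym.
Qed.

Local Notation Sig a := (Sigma0 X g (ofin 1 +o a)).
Local Notation Pi a := (Pi0 X g (ofin 1 +o a)).

Lemma oiso_add1 a b : a =o b -> ofin 1 +o a =o ofin 1 +o b.
Proof. exact: oadd_iso (oiso_refl _). Qed.

Lemma Sig_eq_iso a b : a =o b -> Sig a = Sig b.
Proof. by move=> ab; apply: Sigma0_eq_iso; exact: oiso_add1. Qed.

Lemma Sig0E a : a =o ofin 0 -> Sig a = open.
Proof.
by move=> a0; apply: Sigma0_1E; apply: oiso_trans (oiso_add1 a0) (oadd0 _).
Qed.

Lemma add1_gt1 a : ofin 0 <o a -> ofin 1 <o ofin 1 +o a.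
Proof. by move=> a0; apply: oiso_ltl (oiso_sym (oadd0 _)) _; exact: oadd_lt. Qed.

(** Only the number of sets in a union matters, not the order type that indexes
    it, and the ranks from 1 on are exactly the ordinals [1 + b]. *)
Lemma SigP a U : ofin 0 <o a ->
  Sig a U <-> exists2 m, m <o g & unions_le m (Pi0_below X g a) U.
Proof.
move=> a0; rewrite Sigma0E; last exact: add1_gt1.
split=> [[d [A [dg Ab ->]]]|[m mg /unions_leP[I [A [Im AC ->]]]]].
  exists d => //; apply/unions_leP; exists d, A; split=> [|i|//].
    exact: card_lexx.
  have [b [b1 ba Pb]] := Ab i; have [c bc] := oadd_diff b1.
  exists c; last by rewrite /Pi0 -(Sigma0_eq_iso bc).
  by apply/(@oadd_ltP (ofin 1)); exact: oiso_ltl (oiso_sym bc) ba.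
have [h hsurj] := ocard_surj I; exists (ocard I), (A \o h); split.
- apply: ord_le_lt_trans mg; apply/(is_card_le _ (@is_card_card _)).
  exact: card_le_trans (ocard_card_le _) Im.
- move=> i; have [b ba Pb] := AC (h i); exists (ofin 1 +o b); split=> //.
    exact: le_oaddl.
  exact: oadd_lt.
- apply/seteqP; split=> [x [i _ Ax]|x [i _ Ax]]; last by exists (h i).
  by have [j hj] := hsurj i; exists j => //=; rewrite hj.
Qed.

Lemma Pi0_below_sub a b : a <=o b -> Pi0_below X g a `<=` Pi0_below X g b.
Proof. by move=> ab A [c ca PA]; exists c => //; exact: ord_lt_le_trans ab. Qed.

Lemma Pi0_below_iso a b : a =o b -> Pi0_below X g a = Pi0_below X g b.
Proof.
by move=> ab; apply/seteqP; split; apply: Pi0_below_sub; right => //;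
  exact: oiso_sym.
Qed.

Section Monotone.
Variable mu : ord.
Hypotheses (mug : mu <o g) (g1 : ofin 1 <o g).
Hypothesis Xopen : forall U : set X, open U -> unions_le mu closed U.

Lemma Pi_sub_Sig b a : b <o a -> Pi b `<=` Sig a.
Proof.
move=> ba A PA; apply/(SigP _ (ord_gt0 ba)); exists (ofin 1) => //.
by apply: unions_le1; [exact: ord_lexx|exists b].
Qed.

(** Only the step from open sets upwards is not formal: it holds because open
    sets are short unions of closed sets. *)
Lemma Sig_sub b a : b <=o a -> Sig b `<=` Sig a.
Proof.
move=> ba U SU; have [b0|b0] := ofin0_le b.
  have a0 := ord_lt_le_trans b0 ba.
  have /(SigP _ b0)[m mg mU] := SU; apply/(SigP _ a0); exists m => //.
  exact: unions_le_sub (Pi0_below_sub ba) _ mU.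
have [a0|a0] := ofin0_le a; last first.
  by move: SU; rewrite !Sig0E//; exact: oiso_sym.
move: SU; rewrite Sig0E; last exact: oiso_sym.
move=> /Xopen Uu; apply/(SigP _ a0); exists mu => //.
apply: unions_le_sub Uu => C Cc; exists (ofin 0) => //.
by rewrite /Pi0 Sig0E /=; [exact: closed_openC|exact: oiso_refl].
Qed.

Lemma Pi_sub b a : b <=o a -> Pi b `<=` Pi a.
Proof. by move=> ba A; exact: Sig_sub. Qed.

Lemma Sig_sub_Pi b a : b <o a -> Sig b `<=` Pi a.
Proof. by move=> ba A SA; apply: (Pi_sub_Sig ba); rewrite /Pi0 /= setCK. Qed.

Lemma Pi0_below_succ b : Pi0_below X g (b +o ofin 1) = Pi b.
Proof.
apply/seteqP; split=> [A [c /ord_lt_succP cb]|A PA]; first exact: Pi_sub.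
by exists b => //; exact: ord_ltS.
Qed.

End Monotone.
End Hierarchy.

(** * Collapse of the hierarchies at a singular strong limit cardinal *)

Section Collapse.
Variables (k : ord) (X : topologicalType).
Hypotheses (ksing : is_singular k) (kpow : weak_pow2 k =o k).
Hypothesis Xopen : forall U : set X, open U -> unions_le (cof k) closed U.

Local Notation "''S_' a" := (Sigma0 X k (ofin 1 +o a)) (at level 8, a at level 2).
Local Notation "''P_' a" := (Pi0 X k (ofin 1 +o a)) (at level 8, a at level 2).
Local Notation "''T_' a" := (Sigma0 X (succ_card k) (ofin 1 +o a))
  (at level 8, a at level 2).

Let kc : is_card k. Proof. by case: ksing. Qed.
Let kinf : infinite_set [set: k]. Proof. by case: ksing. Qed.
Let cofk : cof k <o k. Proof. by case: ksing. Qed.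

Let k1 : ofin 1 <o k.
Proof.
apply/(card_ltP _ kc) => h; apply: kinf; apply: card_le_finite h _.
exact: (@finite_finset 'I_1).
Qed.

Let kS : k <o succ_card k.
Proof. by apply/ord_lt_succ_card/card_lexx. Qed.

Let cofkS := ord_lt_trans cofk kS.

Let S_sub a b : a <=o b -> 'S_a `<=` 'S_b.
Proof. exact: Sig_sub cofk Xopen a b. Qed.

Let P_sub a b : a <=o b -> 'P_a `<=` 'P_b.
Proof. exact: Pi_sub cofk Xopen a b. Qed.

Let S_sub_P a b : a <o b -> 'S_a `<=` 'P_b.
Proof. exact: (@Sig_sub_Pi X k k1 a b). Qed.

Lemma S_unions_lt a : ofin 0 <o a -> 'S_a = unions_lt k (Pi0_below X k a).
Proof. by move=> a0; apply/seteqP; split=> U /(SigP _ _ a0). Qed.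

Lemma T_unions_le a : ofin 0 <o a ->
  'T_a = unions_le k (Pi0_below X (succ_card k) a).
Proof.
move=> a0; apply/seteqP; split=> U.
  move=> /(SigP _ _ a0)[m /ord_lt_succ_card mk]; exact: unions_le_card.
by move=> kU; apply/(SigP _ _ a0); exists k.
Qed.

Lemma unions_sub_S m a : m <o k -> ofin 0 <o a ->
  unions_le m (Pi0_below X k a) `<=` 'S_a.
Proof. by move=> mk a0 U mU; apply/(SigP _ _ a0); exists m. Qed.

(** Distributivity turns a short union of [Pi] sets of level [e] into a short
    intersection of [Sigma] sets of level [e], provided these [Pi] sets are
    intersections of fewer than [k] sets from a class [D] whose short unions
    stay in level [e]. *)
Lemma S_eq_P_succ e n (D : set (set X)) : n <o k ->
  'P_e `<=` inters_le n D -> (forall m, m <o k -> unions_le m D `<=` 'S_e) ->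
  'S_(e +o ofin 1) = 'P_(e +o ofin 1).
Proof.
move=> nk PD DS.
have e0 := osucc_gt0 e.
suff SP : 'S_(e +o ofin 1) `<=` 'P_(e +o ofin 1).
  by apply/seteqP; split=> // U /SP; rewrite /Pi0 /= setCK.
move=> U; rewrite S_unions_lt// (Pi0_below_succ cofk Xopen) => -[m mk].
move=> /(unions_le_sub PD)/(unions_inters_distr ksing kpow nk mk)[p pk].
move=> /inters_leC pU; apply: unions_sub_S pk e0 _ _.
rewrite (Pi0_below_succ cofk Xopen); apply: unions_le_sub pU => A /DS; exact.
Qed.

Definition collapse_at a : Prop :=
  (ord_even a -> 'S_a = 'T_(ord_half a) /\
     (ofin 0 <o a -> 'S_a = unions_le (cof_hat k a) (Pi0_below X k a))) /\
  (ord_odd a -> 'S_a = 'P_a).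

Lemma cof_hat_lt a : a <o succ_card k -> cof_hat k a <o k.
Proof.
move=> ak; rewrite /cof_hat; case: pselect => [alim|//].
exact: cof_lt_singular.
Qed.

(** Below a limit a set of additive level [b] has multiplicative level [b + 1];
    below [e + 2] the ambiguous level [e + 1] contains every additive class. *)
Lemma Sigma0_below_sub_Pi0_below a : ord_even a ->
  (forall b, b <o a -> collapse_at b) ->
  Sigma0_below X k a `<=` Pi0_below X k a.
Proof.
move=> aev IH A [b ba SA].
have [a0|alim|[e eev ae]] := ord_even_cases aev.
- by case/ord_ltNle: (oiso_ltr ba a0); exact: ofin0_le.
- exists (b +o ofin 1); first exact: limit_succ_lt.
  exact: S_sub_P (ord_ltS b) _ SA.
- have ea : e +o ofin 1 <o a by apply: oiso_ltr (ord_ltS _) (oiso_sym ae).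
  exists (e +o ofin 1) => //.
  have [_ <-] := IH _ ea; last exact: ord_oddS.
  by apply: S_sub SA; apply/ord_lt_succP; exact: oiso_ltr ba ae.
Qed.

(** At level 0 the class [D] consists of the open sets; at a positive even level
    it is the union of the lower additive classes, which lie in lower
    multiplicative classes, so that their short unions stay in level [e]. *)
Lemma S_eq_P_odd e : e <o succ_card k -> ord_even e ->
  (forall b, b <=o e -> collapse_at b) -> 'S_(e +o ofin 1) = 'P_(e +o ofin 1).
Proof.
move=> ek eev IH; have [e0|e0] := ofin0_le e.
  have [/(_ eev)[_ /(_ e0) SE] _] := IH e (ord_lexx e).
  apply: (S_eq_P_succ (D := Sigma0_below X k e) (cof_hat_lt ek)).
    move=> A; rewrite /Pi0 SE /= => hA; apply/inters_leC.
    exact: hA.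
  move=> m mk; rewrite S_unions_lt// => U mU; exists m => //.
  apply: unions_le_sub mU; apply: Sigma0_below_sub_Pi0_below => // b be.
  by apply: IH; left.
apply: (S_eq_P_succ (D := open) cofk).
  move=> A; rewrite /Pi0 Sig0E /=; last exact: oiso_sym.
  move=> /Xopen Au; apply/inters_leC; apply: unions_le_sub Au => C.
  exact: closed_openC.
move=> m mk U /unions_leP[I [A [_ Ao ->]]]; rewrite Sig0E; last exact: oiso_sym.
by apply: bigcup_open.
Qed.

(** At the next even level, [k] sets of level [e] are grouped into [cof k]
    short unions; these are again [Pi] sets because level [e + 1] is ambiguous. *)
Lemma collapse_succ2 e : ord_even e -> 'S_e = 'T_(ord_half e) ->
  'S_(e +o ofin 1) = 'P_(e +o ofin 1) ->
  [/\ 'S_(e +o ofin 1 +o ofin 1) = unions_le k 'P_e,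
      'S_(e +o ofin 1 +o ofin 1) = 'T_(ord_half (e +o ofin 1 +o ofin 1)) &
      'S_(e +o ofin 1 +o ofin 1) =
        unions_le (cof k) (Pi0_below X k (e +o ofin 1 +o ofin 1))].
Proof.
move=> eev SE SP.
have gt0 := osucc_gt0.
pose below b := Pi0_below_succ cofk Xopen b.
have SlP : 'S_(e +o ofin 1) = unions_lt k 'P_e.
  by rewrite S_unions_lt ?below.
have S_k : 'S_(e +o ofin 1 +o ofin 1) `<=` unions_le k 'P_e.
  rewrite S_unions_lt// below -SP SlP => U /unions_lt_le kU.
  apply: (unions_le_unions kinf); apply: unions_le_sub kU.
  exact: unions_lt_le.
have k_cof : unions_le k 'P_e `<=` unions_le (cof k) 'P_(e +o ofin 1).
  by move=> U /(unions_le_cof ksing); rewrite -SlP SP.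
have cof_S : unions_le (cof k) 'P_(e +o ofin 1) `<=` 'S_(e +o ofin 1 +o ofin 1).
  by rewrite -below; apply: unions_sub_S.
split; first by apply/seteqP; split=> // U /k_cof/cof_S.
  rewrite (Sig_eq_iso _ _ (ord_halfSS e)) T_unions_le//.
  rewrite (Pi0_below_succ cofkS Xopen) /Pi0 -SE.
  by apply/seteqP; split=> // U /k_cof/cof_S.
by rewrite below; apply/seteqP; split=> // U /S_k/k_cof.
Qed.

Section LimitStep.
Variable a : ord.
Hypotheses (alim : is_limit a) (ak : a <o succ_card k).
Hypothesis IH : forall b, b <o a -> collapse_at b.

Let succ_lt b : b <o a -> b +o ofin 1 <o a. Proof. exact: limit_succ_lt. Qed.

Let even_S b : b <o a -> ord_even b -> 'S_b = 'T_(ord_half b).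
Proof. by move=> /IH[h _] /h[]. Qed.

(** Halving maps the even ordinals below a limit onto all ordinals below it. *)
Lemma Pi0_below_limit : Pi0_below X (succ_card k) a = Pi0_below X k a.
Proof.
apply/seteqP; split=> A [b ba PA].
  have [c [cev ca cb]] := limit_half_surj alim ba; exists c => //.
  by move: PA; rewrite /Pi0 -(Sig_eq_iso _ _ cb) -even_S.
have [c [cev ca bc]] : exists c, [/\ ord_even c, c <o a & b <=o c].
  have [bev|bod] := ord_even_or_odd b; first by exists b; split=> //; exact: ord_lexx.
  exists (b +o ofin 1); split; [exact: ord_evenS|exact: succ_lt|].
  by left; exact: ord_ltS.
exists (ord_half c); first exact: ord_le_lt_trans (ord_half_le c) ca.
by move: (P_sub bc PA); rewrite /Pi0 even_S.
Qed.

(** The sets of level at most [f j], for [f] cofinal in [a], are collected into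
    one set whose level is still below [a]. *)
Lemma unions_le_limit :
  unions_le k (Pi0_below X k a) `<=` unions_le (cof a) (Pi0_below X k a).
Proof.
move=> U /unions_leP[I [A [Ik AP ->]]].
have [[f fcof] _] := cofP a; pose lev j := oseg (f j).
pose J j := {i | 'P_(lev j) (A i)}.
apply/unions_leP; exists (cof a), (fun j => \bigcup_(i : J j) A (sval i)); split.
- exact: card_lexx.
- move=> j.
  (* An even level [e] is needed because unions of length [k] of sets of
     multiplicative level [e] are then known to have level [e + 2]. *)
  have [e [eev ea le]] : exists e, [/\ ord_even e, e <o a & lev j <=o e].
    have la : lev j <o a by exact: oseg_lt.
    have [lev_ev|lev_od] := ord_even_or_odd (lev j).
      by exists (lev j); split=> //; exact: ord_lexx.
    exists (lev j +o ofin 1); split; [exact: ord_evenS|exact: succ_lt|].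
    by left; exact: ord_ltS.
  have [|kP _ _] := collapse_succ2 eev (even_S ea eev).
    by have [_ /(_ (ord_oddS eev))] := IH (succ_lt ea).
  exists (e +o ofin 1 +o ofin 1 +o ofin 1); first by do 3 apply: succ_lt.
  apply: (S_sub_P (ord_ltS _)); rewrite kP.
  apply/unions_leP; exists (J j), (fun i => A (sval i)); split=> // [|i].
    by apply: card_le_trans Ik; exact: inj_card_leT (@sval_inj _ _).
  exact: P_sub le _ (svalP i).
- apply/seteqP; split=> [x [i _ Ax]|x [j _ [i _ Ax]]]; last by exists (sval i).
  have [b /ord_lt_oseg[z bz] Pb] := AP i; have [j zj] := fcof z.
  exists j => //; suff Pj : 'P_(lev j) (A i) by exists (exist _ i Pj).
  apply: P_sub Pb; apply: ord_le_trans (or_intror bz) _.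
  exact/oseg_leP.
Qed.

Lemma collapse_limit :
  'S_a = 'T_(ord_half a) /\ 'S_a = unions_le (cof a) (Pi0_below X k a).
Proof.
have a0 := is_limit_gt0 alim.
rewrite (Sig_eq_iso _ _ (ord_half_limit alim)) T_unions_le// Pi0_below_limit.
have cS : unions_le (cof a) (Pi0_below X k a) `<=` 'S_a.
  by apply: unions_sub_S => //; exact: cof_lt_singular.
have Sk : 'S_a `<=` unions_le k (Pi0_below X k a).
  by rewrite S_unions_lt//; exact: unions_lt_le.
split; apply/seteqP; split=> // U.
  by move=> /unions_le_limit/cS.
by move=> /Sk/unions_le_limit.
Qed.

End LimitStep.

Lemma collapse a : a <o succ_card k -> collapse_at a.
Proof.
elim: (ord_lt_wf a) => {}a _ IH ak.
have {}IH b : b <o a -> collapse_at b.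
  by move=> ba; apply: (IH) => //; exact: ord_lt_trans ak.
split=> [aev|/ord_odd_pred[e eev ae]]; last first.
  rewrite /Pi0 (Sig_eq_iso _ _ ae); apply: S_eq_P_odd => //.
    apply: ord_lt_trans ak; exact: oiso_ltr (ord_ltS e) (oiso_sym ae).
  move=> b be; apply: IH; apply: oiso_ltr (oiso_sym ae).
  exact/ord_lt_succP.
have [a0|alim|[e eev ae]] := ord_even_cases aev.
- split=> [|/ord_ltNle]; last by case; right.
  by rewrite Sig0E// Sig0E//; exact: ord_half0.
- have [SE SU] := collapse_limit alim ak IH; split=> // _.
  by rewrite /cof_hat; case: pselect.
have e1a : e +o ofin 1 <o a by apply: oiso_ltr (ord_ltS _) (oiso_sym ae).
have [/(_ eev)[SE _] _] := IH e (ord_lt_trans (ord_ltS e) e1a).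
have [_ /(_ (ord_oddS eev)) SP] := IH _ e1a.
have [_ ST SU] := collapse_succ2 eev SE SP.
rewrite (Sig_eq_iso _ _ (ord_half_iso ae)) (Pi0_below_iso _ _ ae).
rewrite (Sig_eq_iso _ _ ae); split=> // _.
rewrite /cof_hat; case: pselect => // alim.
by have /succ_not_limit := is_limit_iso ae alim.
Qed.

End Collapse.

Theorem theorem5p1 (k : ord) (X : topologicalType)
  (ksing : is_singular k)
  (kunc : ~ countable [set: k])
  (kpow : weak_pow2 k =o k)
  (X0 : [set: X] !=set0)
  (Xreg : regular_space X)
  (XT2 : hausdorff_space X)
  (Xweight : weight_le X k)
  (Xopen : forall U : set X, open U -> unions_le (cof k) closed U)
  (a : ord) (ak : a <o succ_card k) :
  (ord_even a ->
    [/\ Sigma0 X k (ofin 1 +o a) = Sigma0 X (succ_card k) (ofin 1 +o ord_half a),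
        ofin 0 <o a ->
          Sigma0 X k (ofin 1 +o a) = unions_le (cof_hat k a) (Pi0_below X k a),
        Pi0 X k (ofin 1 +o a) = Pi0 X (succ_card k) (ofin 1 +o ord_half a) &
        ofin 0 <o a ->
          Pi0 X k (ofin 1 +o a) = inters_le (cof_hat k a) (Sigma0_below X k a)]) /\
  (ord_odd a ->
    Sigma0 X k (ofin 1 +o a) = Pi0 X k (ofin 1 +o a) /\
    Pi0 X k (ofin 1 +o a) = Delta0 X k (ofin 1 +o a)).
Proof.
have [even_a odd_a] := collapse ksing kpow Xopen ak.
split=> [/even_a[ST SU]|/odd_a SP]; last first.
  by split=> //; rewrite /Delta0 -SP setIid.
split=> //; first by rewrite /Pi0 ST.
move=> /SU {}SU; apply/seteqP; split=> A; rewrite /Pi0 /= SU.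
  by move=> ?; apply/inters_leC.
by move=> /inters_leC.
Qed.
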